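(* Under Assumptions 1 and 3, for every $T\ge1$ there exists a policy $\Pi\in\Pi^C_W$ with $J_{\pi_0}(\Pi,T)=\inf_{\Pi'\in\Pi^C_W}J_{\pi_0}(\Pi',T)$, and with $J^T_T\equiv0$ and $$J^T_t(\pi)=\min_{Q\in\mathcal Q_c}\Big(\tfrac1T c(\pi,Q)+E\big[J^T_{t+1}(\pi_{t+1})\mid\pi_t=\pi,Q_t=Q\big]\Big)$$ for $t=T-1,\dots,1$, $\pi\in\mathcal S$, and for $t=0$, $\pi=\pi_0$, one has $J^T_0(\pi_0)=\min_{\Pi\in\Pi^C_W}J_{\pi_0}(\Pi,T)$.
   Context: Assumption 1: the source is $x_{t+1}=f(x_t,w_t)$ with $f:\mathbb R^d\times\mathbb R^d\to\mathbb R^d$ Borel, $\{w_t\}$ i.i.d. and independent of $x_0\sim\pi_0$; for each $x$ the law of $f(x,w_0)$ has a density $\phi(\cdot|x)$ which is strictly positive everywhere, bounded by $C$ and $C_1$-Lipschitz, uniformly in $x$. Assumption 3: (i) $\|f(x,w)\|\le K(\|x\|+\|w\|)$ for some $K>0$; (ii) $\mathbb U=\mathbb R^d$ and $c_0(x,u)=\|x-u\|^2$; (iii) $\int\|z\|^2\nu_w(dz)<\infty$ where $\nu_w$ is the law of $w_t$; (iv) $\pi_0$ has a density with finite second moment or is a point mass. $\mathcal S$: probability measures on $\mathbb R^d$ with density bounded by $C$ and $C_1$-Lipschitz. $\mathcal Q_c$: Borel maps $Q:\mathbb R^d\to\{1,\dots,M\}$ with all cells $Q^{-1}(i)$ convex.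 $\Pi^C_W$: policies given by Borel maps $\hat\eta_t:\mathcal P(\mathbb R^d)\to\mathcal Q_c$; $Q_t=\hat\eta_t(\pi_t)$, $q_t=Q_t(x_t)$, with $\pi_t(\cdot)=P(x_t\in\cdot\mid q_{[0,t-1]})$. Beliefs evolve by $\pi_{t+1}=\hat\pi(q_t,\pi_t,Q_t)$, $P(q_t=m\mid\pi_t,Q_t)=\pi_t(Q_t^{-1}(m))$, where $\hat\pi(m,\pi,Q)$ has density $z\mapsto\pi(Q^{-1}(m))^{-1}\int_{Q^{-1}(m)}\phi(z|x)\pi(dx)$. Cost $c(\pi,Q)=\sum_i\inf_{u\in\mathbb R^d}\int_{Q^{-1}(i)}\|x-u\|^2\pi(dx)$ and $J_{\pi_0}(\Pi,T)=E^\Pi_{\pi_0}[\frac1T\sum_{t=0}^{T-1}c(\pi_t,Q_t)]$. *)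

(* Defs.v *)
From HB Require Import structures.
From mathcomp Require Import all_boot all_order all_algebra.
From mathcomp Require Import all_classical all_reals all_analysis measurable_realfun.
Set Implicit Arguments. Unset Strict Implicit. Unset Printing Implicit Defensive.
Import Order.TTheory GRing.Theory Num.Theory.
Local Open Scope classical_set_scope.
Local Open Scope ring_scope.

Section ZeroDelay.
Variable R : realType.

(* ---------- R^d as d.-tuple R (product = Borel sigma-algebra) ---------- *)
Notation Rd d := (d.-tuple R).

Definition tsub d (x y : Rd d) : Rd d := [tuple tnth x i - tnth y i | i < d].
Definition tcomb d (l : R) (x y : Rd d) : Rd d :=
  [tuple l * tnth x i + (1 - l) * tnth y i | i < d].
Definition tsqnorm d (x : Rd d) : R := \sum_(i < d) (tnth x i) ^+ 2.
Definition tnorm d (x : Rd d) : R := Num.sqrt (tsqnorm x).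

(* d-dimensional Lebesgue integral of a function g : R^d -> \bar R,
   written as the iterated one-dimensional Lebesgue integrals
   (first coordinate outermost); for nonnegative measurable g this is
   the integral w.r.t. d-dimensional Lebesgue measure (Tonelli). *)
Fixpoint iint (n : nat) : (Rd n -> \bar R) -> \bar R :=
  match n return (Rd n -> \bar R) -> \bar R with
  | 0 => fun g => g [tuple]
  | n'.+1 => fun g =>
      (\int[@lebesgue_measure R]_x iint (fun t : Rd n' => g (cons_tuple x t)))%E
  end.

Definition has_density d (P : probability (Rd d) R) (g : Rd d -> R) :=
  (forall z, 0 <= g z) /\ measurable_fun setT g /\
  forall A : set (Rd d), measurable A ->
    P A = iint (fun z => (\1_A z * g z)%:E).

Definition inS d (C C1 : R) (P : probability (Rd d) R) :=
  exists g, has_density P g /\ (forall z, g z <= C) /\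
    forall z z', `|g z - g z'| <= C1 * tnorm (tsub z z').

Definition quantizer d M := Rd d -> 'I_M.

Definition convex_set d (A : set (Rd d)) :=
  forall x y l, A x -> A y -> 0 <= l <= 1 -> A (tcomb l x y).

Definition Qc d M (Q : quantizer d M) :=
  forall i : 'I_M, measurable (Q @^-1` [set i]) /\ convex_set (Q @^-1` [set i]).

Definition qcost d M (P : probability (Rd d) R) (Q : quantizer d M) : \bar R :=
  (\sum_(i < M)
     ereal_inf [set (\int[P]_(x in Q @^-1` [set i]) (tsqnorm (tsub x u))%:E)
               | u in [set: Rd d]])%E.

(* Borel sigma-algebra on P(R^d): generated by the evaluation maps P |-> P A *)
Definition Pgen d : set_system (probability (Rd d) R) :=
  [set E | exists A : set (Rd d), measurable A /\
           exists B : set (\bar R), measurable B /\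
             E = [set P : probability (Rd d) R | B (P A)]].
Definition Pmeasurable d (E : set (probability (Rd d) R)) := <<s @Pgen d >> E.

Definition Qgen d M : set_system (quantizer d M) :=
  [set E | exists (x : Rd d) (m : 'I_M), E = [set Q : quantizer d M | Q x = m]].
Definition Qmeasurable d M (E : set (quantizer d M)) := <<s @Qgen d M >> E.

Definition policy d M := nat -> probability (Rd d) R -> quantizer d M.

Definition is_policy d M (eta : policy d M) :=
  forall t : nat,
    (forall P, Qc (eta t P)) /\
    (forall E, Qmeasurable E -> Pmeasurable (eta t @^-1` E)).

Definition belief_update d M :=
  'I_M -> probability (Rd d) R -> quantizer d M -> probability (Rd d) R.

Definition is_belief_update d M (phi : Rd d -> Rd d -> R)
    (upd : belief_update d M) :=
  forall (m : 'I_M) (P : probability (Rd d) R) (Q : quantizer d M),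
    Qc Q -> (0 < P (Q @^-1` [set m]))%E ->
    forall A : set (Rd d), measurable A ->
      upd m P Q A =
      ((fine (P (Q @^-1` [set m])))^-1%:E *
        iint (fun z => (\1_A z)%:E *
                 \int[P]_(x in Q @^-1` [set m]) (phi z x)%:E))%E.

Section Cost.
Variables (d M T : nat) (upd : belief_update d M).

(* value of policy eta from time t at belief P, k steps remaining;
   E[ J_{t+1}(pi_{t+1}) | pi_t = P, Q_t = Q ]
     = sum_m P(Q^-1 m) J_{t+1}(pi-hat(m,P,Q)) *)
Fixpoint policy_value (eta : policy d M) (k t : nat) (P : probability (Rd d) R)
    : \bar R :=
  match k with
  | 0 => 0%E
  | k'.+1 =>
      let Q := eta t P in
      ((T%:R^-1)%:E * qcost P Q +
       \sum_(m < M) P (Q @^-1` [set m]) * policy_value eta k' t.+1 (upd m P Q))%E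
  end.

(* J_{pi0}(Pi, T) = E[ (1/T) sum_{t<T} c(pi_t, Q_t) ] *)
Definition Jcost (eta : policy d M) (P0 : probability (Rd d) R) : \bar R :=
  policy_value eta T 0 P0.

Definition dp_bracket (Jnext : probability (Rd d) R -> \bar R)
    (P : probability (Rd d) R) (Q : quantizer d M) : \bar R :=
  ((T%:R^-1)%:E * qcost P Q +
   \sum_(m < M) P (Q @^-1` [set m]) * Jnext (upd m P Q))%E.

Fixpoint Jrem (k : nat) (P : probability (Rd d) R) : \bar R :=
  match k with
  | 0 => 0%E
  | k'.+1 => ereal_inf [set dp_bracket (Jrem k') P Q | Q in @Qc d M]
  end.

Definition JT (t : nat) := Jrem (T - t).

End Cost.

End ZeroDelay.

(* Main.v *)
(* Beliefs reached from [pi0] form a finite tree, so measurable selection reduces to choosing an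
   optimal quantizer at finitely many beliefs, separated from one another by finitely many
   events.  What remains is the existence of an optimal quantizer at each belief, i.e. a compactness
   and semicontinuity argument.

   Compactness: an ultrafilter limit of quantizers with convex cells has convex cells, and a finite
   partition of R^d into convex sets is automatically Borel and locally constant off finitely many
   hyperplanes; convexity then turns convergence along a countable dense set into convergence off
   these hyperplanes, which are null for the laws at hand.

   Semicontinuity: call [Pn] convergent to [P] when the integrals of [h_n] converge to that of [h]
   for all [h_n] dominated by [c (1 + |x|^2)] and converging off a null set.  A constant
   sequence converges by dominated convergence, and this notion is preserved by the belief update
   because the transition kernel maps such [h_n] to functions of the same kind.  The cost of a cell
   is a continuous function of its first moments, so the value functions are lower semicontinuous by
   induction on the number of remaining steps. *)

(* Cells have discontinuous indicators and the quantizers vary together with the beliefs, so fixed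
   continuous test functions would not pass to the limit. Hence test functions that vary with the
   index and may fail to converge on a null set. That set must be null for the limit belief and also
   for all transition laws: averaging over the noise then yields convergence at every state, so the
   exceptional set of the test functions disappears at each update. The quadratic weight dominates
   the distortion, and linear growth of [f] with square integrable noise makes the kernel map it
   below a multiple of itself. Two kinds of beliefs need separate care. A point mass charges
   hyperplanes, so convergence of quantizers is also secured at one prescribed point. A belief in
   [inS] may have infinite second moment; then every quantizer has infinite cost, and each of them
   is a minimizer. *)
Require Import Defs.
From HB Require Import structures.
From mathcomp Require Import all_boot all_order all_algebra.
From mathcomp Require Import all_classical all_reals all_analysis measurable_realfun.
From mathcomp Require Import ring lra.
Import Order.TTheory GRing.Theory Num.Theory.
Import numFieldNormedType.Exports.
Local Open Scope classical_set_scope.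
Local Open Scope ring_scope.
Set Implicit Arguments. Unset Strict Implicit. Unset Printing Implicit Defensive.

(** * Separation of convex sets *)

(* [C] is the positive cone of a total order on the vector space.  One of the signed basis vectors,
   [u], dominates all others, and the functional maps [x] to the supremum of the [r] such that
   [r *: u] is below [x]. *)
Lemma total_cone_functional (R : realType) n (C : set 'rV[R]_n)
  (CD : forall x y, C x -> C y -> C (x + y))
  (CZ : forall r x, 0 < r -> C x -> C (r *: x))
  (Cne : C !=set0) (C0 : ~ C 0)
  (Ctot : forall v, v != 0 -> C v \/ C (- v)) :
  exists a : 'cV[R]_n, a != 0 /\ forall x, C x -> 0 <= (x *m a) 0 0.
Proof.
have [p0 Cp0] := Cne.
have p0n0 : p0 != 0 by apply/eqP => p00; apply: C0; rewrite -p00.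
pose e (i : 'I_n) : 'rV[R]_n := if `[< C (delta_mx 0 i) >] then delta_mx 0 i else - delta_mx 0 i.
have dn0 (i : 'I_n) : (delta_mx 0 i : 'rV[R]_n) != 0.
  by apply/eqP => /matrixP/(_ 0 i)/eqP; rewrite !mxE !eqxx oner_eq0.
have Ce i : C (e i).
  rewrite /e; case: asboolP => // nC.
  by case: (Ctot _ (dn0 i)).
(* With x below y when [y - x] is in [C], [dom i j] says that [e i] lies below a positive multiple
   of [e j]. This total preorder on a finite set has a largest element [k]. *)
pose dom i j := exists2 c, 0 < c & C (c *: e j - e i).
have domtot i j : dom i j \/ dom j i.
  have [E|] := eqVneq (e j - e i) 0.
    (* [C] is strict and does not contain [e j - e i = 0]; the factor 2 leaves [e i], which is in
       [C]. *)
    left; exists 2 => //; rewrite (_ : _ - _ = e i + 2 *: (e j - e i)); first by rewrite E scaler0 addr0.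
    rewrite scalerBr addrCA; congr (_ + _).
    by rewrite scalerDl scale1r opprD addNKr.
  move=> /Ctot [H|H].
    by left; exists 1 => //; rewrite scale1r.
  right; exists 2 => //; rewrite scalerDl scale1r -addrA addrC; apply: CD => //.
  by rewrite -opprB.
have domtr i j k : dom i j -> dom j k -> dom i k.
  move=> [c c0 H] [c' c'0 H']; exists (c * c'); first exact: mulr_gt0.
  have := CD _ _ H (CZ _ _ c0 H').
  by rewrite scalerBr scalerA addrC addrA subrK.
have domrefl i : dom i i by case: (domtot i i).
have [k0 _] : exists k0 : 'I_n, True.
  have n0 : (0 < n)%N.
    rewrite lt0n; apply: contraNneq p0n0 => n0; apply/eqP/rowP => j.
    by have := ltn_ord j; rewrite {2}n0.
  by exists (Ordinal n0).
have [k hk] : exists k, forall i, i \in enum 'I_n -> dom i k.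
  elim: (enum 'I_n) => [|j s [k hk]]; first by exists k0.
  have [jk|kj] := domtot j k.
    by exists k => i; rewrite inE => /orP[/eqP->//|/hk].
  exists j => i; rewrite inE => /orP[/eqP->//|/hk ik].
  exact: domtr ik kj.
pose u := e k.
have Cu : C u := Ce k.
have Czpos r : C (r *: u) -> 0 < r.
  move=> H; rewrite ltNge; apply/negP; rewrite le_eqVlt => /orP[/eqP r0|r0].
    by apply: C0; rewrite r0 scale0r in H.
  apply: C0; have Nr : 0 < - r by rewrite oppr_gt0.
  by have := CD _ _ H (CZ _ _ Nr Cu); rewrite scaleNr subrr.
pose S i := [set r | C (e i - r *: u)].
have S0 i : S i 0 by rewrite /S /= scale0r subr0.
have Sub i : exists2 c, 0 < c & forall r, S i r -> r <= c.
  have [c c0 H] := hk i (mem_enum _ _); exists c => // r Sr.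
  have := CD _ _ H Sr; rewrite addrA subrK -scalerBl => /Czpos.
  by rewrite subr_gt0 => /ltW.
pose al i := sup (S i).
have Ssup i : has_sup (S i).
  by split; [exists 0 | have [c _ Hc] := Sub i; exists c => r /Hc].
have Sdown i r eps : 0 < eps -> S i r -> S i (r - eps).
  move=> e0 Sr; have := CD _ _ Sr (CZ _ _ e0 Cu).
  by rewrite /S /= scalerBl opprB addrA addrAC.
have lowS i eps : 0 < eps -> C ((eps - al i) *: u - - e i).
  move=> e0; have [r Sr lr] := sup_adherent e0 (Ssup i).
  have : S i (al i - eps).
    have [->//|rne] := eqVneq (al i - eps) r.
    have d0 : 0 < r - (al i - eps) by rewrite subr_gt0.
    by have := Sdown _ _ _ d0 Sr; rewrite subKr.
  by rewrite /S /= opprK -scaleNr opprB addrC.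
have upS i eps : 0 < eps -> C ((al i + eps) *: u - e i).
  move=> e0.
  have nS r : al i < r -> ~ S i r.
    by move=> lr Sr; have := ub_le_sup (Ssup i).2 Sr; rewrite leNgt lr.
  have lt1 : al i < al i + eps / 2 by rewrite ltrDl divr_gt0.
  have h0 : 0 < eps / 2 by rewrite divr_gt0.
  have E : (al i + eps) *: u - e i = (eps/2) *: u + - (e i - (al i + eps / 2) *: u).
    rewrite opprB addrA -scalerDl; congr (_ *: _ - _); lra.
  rewrite E.
  have [z|/Ctot[H|H]] := eqVneq (e i - (al i + eps / 2) *: u) 0.
  - by rewrite z oppr0 addr0; apply: CZ.
  - by have := nS _ lt1 H.
  - by apply: CD => //; apply: CZ.
pose s i : R := if `[< C (delta_mx 0 i) >] then 1 else -1.
have sE i : delta_mx 0 i = s i *: e i :> 'rV[R]_n.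
  by rewrite /s /e; case: asboolP => _; rewrite ?scale1r// scaleN1r opprK.
pose a : 'cV[R]_n := \col_i (s i * al i).
(* [D] collects the [x] below [(a(x) + eps) u] for every [eps > 0]. It is a convex cone containing
   each [e i] and its opposite, hence the whole space. *)
pose D := [set x : 'rV[R]_n | forall eps, 0 < eps -> C (((x *m a) 0 0 + eps) *: u - x)].
have DD x y : D x -> D y -> D (x + y).
  move=> Dx Dy eps e0; have h0 : 0 < eps / 2 by rewrite divr_gt0.
  have := CD _ _ (Dx _ h0) (Dy _ h0); congr (C _).
  rewrite addrACA -opprD -scalerDl mulmxDl [in RHS]mxE; congr (_ *: _ - _); lra.
have D0 : D 0 by move=> eps e0; rewrite mul0mx mxE add0r subr0; apply: CZ.
have DZ r x : 0 <= r -> D x -> D (r *: x).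
  rewrite le_eqVlt => /orP[/eqP <-|r0]; first by rewrite scale0r.
  move=> Dx eps e0; have h0 : 0 < eps / r by rewrite divr_gt0.
  have := CZ _ _ r0 (Dx _ h0); congr (C _).
  rewrite scalerBr scalerA -scalemxAl [in RHS]mxE; congr (_ *: _ - _).
  by rewrite mulrDr [r * (eps / r)]mulrC divfK// gt_eqF.
have da i : ((delta_mx 0 i : 'rV[R]_n) *m a) 0 0 = s i * al i.
  by rewrite -rowE !mxE.
have ss i : s i * s i = 1 by rewrite /s; case: ifP; rewrite ?mulr1// mulrNN mulr1.
have De i : D (e i) /\ D (- e i).
  have ea : (e i *m a) 0 0 = al i.
    have -> : e i = s i *: delta_mx 0 i by rewrite sE scalerA ss scale1r.
    by rewrite -scalemxAl [LHS]mxE da mulrA ss mul1r.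
  split => eps e0; first by rewrite ea; apply: upS.
  have -> : ((- e i) *m a) 0 0 = - al i by rewrite mulNmx [LHS]mxE ea.
  by rewrite [- al i + eps]addrC; apply: lowS.
have Dd i r : D (r *: delta_mx 0 i).
  rewrite sE scalerA; have [h|h] := lerP 0 (r * s i); first exact: DZ (De i).1.
  by rewrite -[_ *: _]opprK -scalerN -scaleNr; apply: DZ (De i).2; rewrite oppr_ge0 ltW.
have Dall x : D x.
  by rewrite (row_sum_delta x); apply: (big_ind D) => // i _; exact: Dd.
exists a; split.
  (* If [a] vanished, [D u] at [eps = 1/2] would put [- u / 2] in [C]. *)
  apply/eqP => a0; have h0 : 0 < (2^-1 : R) by rewrite invr_gt0.
  have := Dall u _ h0; rewrite a0 mulmx0 mxE add0r -[X in _ - X]scale1r -scalerBl => /Czpos.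
  by rewrite subr_gt0 ltNge; apply/negP; rewrite negbK invf_le1// ler1n.
move=> x Cx; apply/ler_addgt0Pr => eps e0.
by have := CD _ _ Cx (Dall x _ e0); rewrite addrC subrK => /Czpos/ltW.
Qed.

(* If neither [v] nor [- v] is in [C], project along [v] and use induction on the dimension. *)
Lemma cone_functional (R : realType) n (C : set 'rV[R]_n)
  (CD : forall x y, C x -> C y -> C (x + y))
  (CZ : forall r x, 0 < r -> C x -> C (r *: x))
  (Cne : C !=set0) (C0 : ~ C 0) :
  exists a : 'cV[R]_n, a != 0 /\ forall x, C x -> 0 <= (x *m a) 0 0.
Proof.
have [m] := ubnP n; elim: m => // m IH in n C CD CZ Cne C0 *; rewrite ltnS => nm.
have [[v [vn0 nv nNv]]|tot] := pselect (exists v, [/\ v != 0, ~ C v & ~ C (- v)]); last first.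
  apply: total_cone_functional => // v vn0; apply: contrapT => /not_orP[h1 h2].
  by apply: tot; exists v.
(* Right multiplication by [B] has the line of [v] as kernel: it is the quotient by that line, in
   coordinates. *)
pose B := col_base (cokermx v).
have BE x : x *m B = 0 -> exists r, x = r *: v.
  move=> xB; apply/sub_rVP; rewrite submxE -(mulmx_base (cokermx v)) mulmxA.
  by rewrite xB mul0mx.
have n0 : (0 < n)%N.
  rewrite lt0n; apply: contraNneq vn0 => n0; apply/eqP/rowP => j.
  by have := ltn_ord j; rewrite {2}n0.
have rn : (\rank (cokermx v) < m)%N.
  rewrite mxrank_coker rank_rV vn0; apply: leq_trans nm; by rewrite subn1 prednK.
pose C' := [set y | exists2 x, C x & y = x *m B].
have [||||a [an0 ha]] := IH _ C' _ _ _ _ rn.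
- by move=> _ _ [x Cx ->] [y Cy ->]; exists (x + y); rewrite ?mulmxDl//; exact: CD.
- by move=> r _ r0 [x Cx ->]; exists (r *: x); rewrite ?scalemxAl//; exact: CZ.
- by have [x Cx] := Cne; exists (x *m B), x.
(* A point of [C] on the line of [v] is [r *: v]; each sign of [r] is excluded by the choice of [v]
   or by [C0]. *)
- move=> [x Cx /esym/BE[r xr]]; have [r0|r0|r0] := ltrgtP r 0.
  + apply: nNv; have : C ((- r)^-1 *: x) by apply: CZ => //; rewrite invr_gt0 oppr_gt0.
    by rewrite xr scalerA invrN mulNr mulVf ?scaleN1r// lt_eqF.
  + apply: nv; have : C (r^-1 *: x) by apply: CZ => //; rewrite invr_gt0.
    by rewrite xr scalerA mulVf ?scale1r// gt_eqF.
  + by apply: C0; rewrite -(scale0r v) -r0 -xr.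
exists (B *m a); split.
  have /row_fullP[B' B'B] := col_base_full (cokermx v).
  apply/eqP => Ba0; move: an0; apply/negP; rewrite negbK; apply/eqP.
  by rewrite -[a]mul1mx -B'B -mulmxA Ba0 mulmx0.
by move=> x Cx; rewrite mulmxA; apply: ha; exists x.
Qed.

Section Separation.
Variable R : realType.

Definition dotp d (a x : d.-tuple R) : R := \sum_(i < d) tnth a i * tnth x i.

Definition hyper d (a : d.-tuple R) (b : R) : set (d.-tuple R) := [set x | dotp a x = b].

(* [a = 0] with [b != 0] is allowed: it encodes the trivial separation of an empty set,
   which is the only one available when [d = 0]. *)
Definition nontriv d (a : d.-tuple R) (b : R) := (exists i, tnth a i != 0) \/ b != 0.

Lemma tcomb_tnth d l (x y : d.-tuple R) i :
  tnth (tcomb l x y) i = l * tnth x i + (1 - l) * tnth y i.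
Proof. by rewrite tnth_mktuple. Qed.

(** Sending [x] to [(1, x)] turns affine separation in dimension [d] into linear separation in
    dimension [d + 1]: differences of the cones over [B] and [A] form a convex cone, which avoids 0
    because the sets are disjoint. *)
Lemma convex_separation d (A B : set (d.-tuple R)) :
  Defs.convex_set A -> Defs.convex_set B -> (forall x, A x -> B x -> False) ->
  exists a b, [/\ nontriv a b, (forall x, A x -> dotp a x <= b)
    & (forall x, B x -> b <= dotp a x)].
Proof.
move=> cA cB AB.
pose hv (x : d.-tuple R) : 'rV[R]_d.+1 :=
  \row_i (if unlift ord0 i is Some j then tnth x j else 1).
have hv0 x : hv x 0 ord0 = 1 by rewrite mxE unlift_none.
have hvS x j : hv x 0 (lift ord0 j) = tnth x j by rewrite mxE liftK.
(* At [t = 0] the point is unconstrained, so the cone contains 0 even over an empty set; this covers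
   the case where only one of the two sets is empty. *)
pose K A := [set v | exists t x, [/\ 0 <= t, (0 < t -> A x) & v = t *: hv x]].
have KD A' : Defs.convex_set A' -> forall v w, K A' v -> K A' w -> K A' (v + w).
  move=> cA' v w [t [x [t0 Ax ->]]] [s [y [s0 Ay ->]]].
  move: t0; rewrite le_eqVlt => /orP[/eqP<-|t0].
    by exists s, y; rewrite scale0r add0r.
  move: s0; rewrite le_eqVlt => /orP[/eqP<-|s0].
    by exists t, x; rewrite scale0r addr0 ltW.
  have ts0 : 0 < t + s by rewrite addr_gt0.
  exists (t + s), (tcomb (t / (t + s)) x y); split; first exact: ltW.
    move=> _; apply: cA'; [exact: Ax|exact: Ay|].
    by rewrite divr_ge0 ?(ltW t0) ?(ltW ts0)//= ler_pdivrMr// mul1r lerDl ltW.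
  apply/rowP => i; rewrite !mxE; case: unliftP => [j|] _; rewrite ?mulr1//.
  by rewrite tcomb_tnth; field; rewrite gt_eqF.
have KZ A' r v : 0 < r -> K A' v -> K A' (r *: v).
  move=> r0 [t [x [t0 Ax ->]]]; exists (r * t), x; rewrite scalerA; split => //.
    by rewrite mulr_ge0// ltW.
  by rewrite pmulr_rgt0.
pose C := [set v | exists u w, [/\ K A u, K B w, u != 0 \/ w != 0 & v = w - u]].
have K0 A' u : K A' u -> u 0 ord0 = 0 -> u = 0.
  by move=> [t [x [_ _ ->]]]; rewrite mxE hv0 mulr1 => ->; rewrite scale0r.
have Kge A' u : K A' u -> 0 <= u 0 ord0.
  by move=> [t [x [t0 _ ->]]]; rewrite mxE hv0 mulr1.
have KDn A' u v : K A' u -> K A' v -> u != 0 -> u + v != 0.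
  move=> Ku Kv; apply: contraNneq => uv0; apply/eqP; apply: (K0 A') => //.
  have := congr1 (fun m : 'rV_d.+1 => m 0 ord0) uv0; rewrite !mxE.
  have := Kge _ _ Ku; have := Kge _ _ Kv; lra.
(* [C] is empty only if both sets are, and then the degenerate pair [a = 0], [b = 1] separates
   them. *)
have [neC|neC] := pselect (C !=set0); last first.
  have [AC BC] : (forall x, ~ A x) /\ (forall x, ~ B x).
    split=> x Ax; apply: neC.
      exists (- hv x), (hv x), 0; rewrite sub0r; split => //.
      + by exists 1, x; rewrite scale1r ler01.
      + by exists 0, x; rewrite scale0r ltxx.
      + by left; apply/eqP => /rowP/(_ ord0)/eqP; rewrite hv0 mxE oner_eq0.
    exists (hv x), 0, (hv x); rewrite subr0; split => //.
    + by exists 0, x; rewrite scale0r ltxx.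
    + by exists 1, x; rewrite scale1r ler01.
    + by right; apply/eqP => /rowP/(_ ord0)/eqP; rewrite hv0 mxE oner_eq0.
  exists [tuple 0 | _ < d], 1; split; first by right; rewrite oner_eq0.
    by move=> x /AC.
  by move=> x /BC.
have [] := @cone_functional R _ C.
- move=> _ _ [u [w [Ku Kw uw ->]]] [u' [w' [Ku' Kw' uw' ->]]].
  exists (u + u'), (w + w'); split; [exact: KD|exact: KD| |by rewrite opprD addrACA].
  by case: uw => h; [left; exact: (KDn A)|right; exact: (KDn B)].
- move=> r _ r0 [u [w [Ku Kw uw ->]]]; exists (r *: u), (r *: w).
  rewrite scalerBr; split; [exact: KZ|exact: KZ| |by []].
  by rewrite !scaler_eq0 gt_eqF.
- exact: neC.
- move=> [u [w [Ku Kw uw /esym/eqP]]]; rewrite subr_eq0 => /eqP wu.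
  move: Ku Kw uw wu => [t [x [t0 Ax ->]]] [s [y [s0 By ws]]] {}uw wu.
  move: wu; rewrite ws => /rowP E.
  (* The first coordinates give [t = s]; if this is positive, the others give [x = y], a common
     point of [A] and [B]. *)
  have := E ord0; rewrite !mxE unlift_none !mulr1 => st.
  move: t0; rewrite le_eqVlt => /orP[/eqP t0|t0].
    by move: uw; rewrite ws st -t0 !scale0r !eqxx => -[].
  have xy : x = y.
    apply/eq_from_tnth => j; have := E (lift ord0 j).
    by rewrite !mxE liftK st => /mulfI/esym -> //; rewrite gt_eqF.
  by apply: (AB x); [exact: Ax|rewrite xy; apply: By; rewrite st].
move=> a [an0 ha].
pose a' := [tuple a (lift ord0 j) 0 | j < d].
have dE x : (hv x *m a) 0 0 = a ord0 0 + dotp a' x.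
  rewrite mxE big_ord_recl hv0 mul1r; congr (_ + _).
  by apply: eq_bigr => j _; rewrite hvS tnth_mktuple mulrC.
exists a', (- a ord0 0); split.
- apply: contrapT => /not_orP[h1 /negP]; rewrite negbK oppr_eq0 => /eqP h2.
  move: an0; apply/negP; rewrite negbK; apply/eqP/colP => i; rewrite mxE.
  case: (unliftP ord0 i) => [j ->|->//].
  apply: contrapT => /eqP h; apply: h1; exists j.
  by rewrite tnth_mktuple.
- move=> x Ax; suff : 0 <= (- hv x *m a) 0 0.
    by rewrite mulNmx mxE dE; lra.
  apply: ha; exists (hv x), 0; rewrite sub0r; split => //.
  + by exists 1, x; rewrite scale1r ler01.
  + by exists 0, x; rewrite scale0r ltxx.
  + by left; apply/eqP => /rowP/(_ ord0)/eqP; rewrite hv0 mxE oner_eq0.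
- move=> x Bx; suff : 0 <= (hv x *m a) 0 0 by rewrite dE; lra.
  apply: ha; exists 0, (hv x); rewrite subr0; split => //.
  + by exists 0, x; rewrite scale0r ltxx.
  + by exists 1, x; rewrite scale1r ler01.
  + by right; apply/eqP => /rowP/(_ ord0)/eqP; rewrite hv0 mxE oner_eq0.
Qed.

Lemma convex_partition_separation d M (Q : quantizer R d M) :
  (forall i, Defs.convex_set (Q @^-1` [set i])) ->
  exists (a : 'I_M -> 'I_M -> d.-tuple R) (b : 'I_M -> 'I_M -> R),
  forall i j, i != j -> [/\ nontriv (a i j) (b i j),
    (forall x, Q x = i -> dotp (a i j) x <= b i j)
    & (forall x, Q x = j -> b i j <= dotp (a i j) x)].
Proof.
move=> cQ.
have /choice[f hf] (p : 'I_M * 'I_M) : exists q : d.-tuple R * R, p.1 != p.2 ->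
    [/\ nontriv q.1 q.2,
    (forall x, Q x = p.1 -> dotp q.1 x <= q.2)
    & (forall x, Q x = p.2 -> q.2 <= dotp q.1 x)].
  have [->|ne] := eqVneq p.1 p.2; first by exists ([tuple 0 | _ < d], 0).
  have [|a [b [? ? ?]]] := @convex_separation d _ _ (cQ p.1) (cQ p.2).
    by move=> x /= -> /eqP; apply/negP.
  by exists (a, b).
exists (fun i j => (f (i, j)).1), (fun i j => (f (i, j)).2) => i j; exact: hf (i, j).
Qed.

Lemma measurable_dotp d (a : d.-tuple R) : measurable_fun [set: d.-tuple R] (dotp a).
Proof.
by apply: measurable_sum => i; apply: measurable_funM => //; exact: measurable_tnth.
Qed.

Lemma measurable_hyper d (a : d.-tuple R) b : measurable (hyper a b).
Proof.
rewrite (_ : hyper a b = setT `&` dotp a @^-1` [set b]); last by rewrite setTI.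
exact: measurable_dotp.
Qed.

Definition tdel d (k : 'I_d.+1) (x : d.+1.-tuple R) : d.-tuple R :=
  [tuple tnth x (lift k j) | j < d].

(** Solves the equation of the hyperplane for coordinate [k]. The map is affine, so it pulls convex
    cells back to convex cells in one dimension less. *)
Definition hyper_param d (k : 'I_d.+1) (a : d.+1.-tuple R) (b : R) (y : d.-tuple R) :
    d.+1.-tuple R :=
  [tuple if unlift k i is Some j then tnth y j
         else (b - dotp (tdel k a) y) / tnth a k | i < d.+1].

Lemma dotp_tdel d (k : 'I_d.+1) (a x : d.+1.-tuple R) :
  dotp a x = tnth a k * tnth x k + dotp (tdel k a) (tdel k x).
Proof.
rewrite /dotp (bigD1_ord k)//=; congr (_ + _).
by apply: eq_bigr => j _; rewrite !tnth_mktuple.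
Qed.

Lemma hyper_paramK d (k : 'I_d.+1) (a x : d.+1.-tuple R) b :
  tnth a k != 0 -> hyper a b x -> hyper_param k a b (tdel k x) = x.
Proof.
move=> ak /=; rewrite /hyper /= (dotp_tdel k) => E.
apply/eq_from_tnth => i; rewrite tnth_mktuple; case: unliftP => [j|] ->.
  by rewrite tnth_mktuple.
by rewrite -E addrK mulrC mulKf.
Qed.

Lemma dotp_tcomb d (a x y : d.-tuple R) l :
  dotp a (tcomb l x y) = l * dotp a x + (1 - l) * dotp a y.
Proof.
rewrite /dotp !mulr_sumr -big_split; apply: eq_bigr => i _ /=.
by rewrite tcomb_tnth; ring.
Qed.

Lemma hyper_param_tcomb d (k : 'I_d.+1) a b (x y : d.-tuple R) l :
  hyper_param k a b (tcomb l x y) = tcomb l (hyper_param k a b x) (hyper_param k a b y).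
Proof.
apply/eq_from_tnth => i; rewrite tcomb_tnth !tnth_mktuple.
by case: unliftP => [j|] _; rewrite ?tcomb_tnth// dotp_tcomb; ring.
Qed.

Lemma measurable_tdel d (k : 'I_d.+1) : measurable_fun setT (tdel k).
Proof.
apply/measurable_fun_tnthP => j.
rewrite (_ : _ \o _ = fun x => tnth x (lift k j)); first exact: measurable_tnth.
by apply/funext => x /=; rewrite tnth_mktuple.
Qed.

Lemma convex_cell_decomposition d M (Q : quantizer R d M) i :
  (forall i, Defs.convex_set (Q @^-1` [set i])) ->
  (forall a b, (exists k, tnth a k != 0) -> measurable (Q @^-1` [set i] `&` hyper a b)) ->
  measurable (Q @^-1` [set i]).
Proof.
move=> cQ mQH; have [a [b hab]] := convex_partition_separation cQ.
rewrite (_ : Q @^-1` [set i] =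
    (\bigcap_(j in [set j | j != i]) (setT `&` dotp (a i j) @^-1` `]-oo, b i j[)) `|`
    \bigcup_(j in [set j | j != i]) (Q @^-1` [set i] `&` hyper (a i j) (b i j))); last first.
  apply/seteqP; split => [x /= Qx|x [/= H|[j /= ji [//]]]].
    have [H|/existsNP[j /not_implyP[ji nj]]] :=
       pselect (forall j, j != i -> dotp (a i j) x < b i j).
      by left => j /= ji; split => //=; rewrite in_itv/= H.
    right; exists j => //; split => //=; rewrite /hyper /=.
    have ij : i != j by rewrite eq_sym.
    have [_ /(_ _ Qx) le1 _] := hab _ _ ij.
    by apply/eqP; rewrite eq_le le1 /= leNgt; apply/negP.
  apply: contrapT => /eqP ji; have ij : i != Q x by rewrite eq_sym.
  have [_ _ /(_ x erefl)] := hab _ _ ij; apply/negP; rewrite -ltNge.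
  by have [_] := H _ ji; rewrite /= in_itv.
apply: measurableU; [apply: fin_bigcap_measurable|apply: fin_bigcup_measurable];
  try exact: finite_finset.
  by move=> j /= ji; apply: measurable_dotp => //; exact: measurable_itv.
move=> j /= ji; have ij : i != j by rewrite eq_sym.
(* A zero normal forces a nonzero right-hand side, and the hyperplane is then empty. *)
have [k|a0] := pselect (exists k, tnth (a i j) k != 0); first exact: mQH.
have [[//|b0] _ _] := hab _ _ ij.
rewrite (_ : hyper _ _ = set0) ?setI0//; apply/seteqP; split => x //=.
rewrite /hyper /= /dotp big1 => [/esym/eqP|k _]; first by apply/negP.
by have [->|nk] := eqVneq (tnth (a i j) k) 0; [rewrite mul0r|case: a0; exists k].
Qed.

(* A cell is an intersection of open half-spaces up to points lying on finitely many
   hyperplanes, which are dealt with by induction on the dimension. *)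
Lemma convex_partition_measurable d M (Q : quantizer R d M) :
  (forall i, Defs.convex_set (Q @^-1` [set i])) ->
  forall i, measurable (Q @^-1` [set i]).
Proof.
elim: d => [|d IH] in Q *; move=> cQ i; apply: convex_cell_decomposition => // a b [k ak].
  by case: k ak.
rewrite (_ : _ `&` _ = hyper a b `&` tdel k @^-1` ((Q \o hyper_param k a b) @^-1` [set i])).
  apply: measurableI; first exact: measurable_hyper.
  rewrite -[X in measurable X]setTI; apply: measurable_tdel => //.
  apply: IH => {}i x y l /= Qx Qy l01.
  by rewrite hyper_param_tcomb; apply: cQ.
apply/seteqP; split => x /= [].
  by move=> Qx hx; rewrite hyper_paramK.
by move=> hx; rewrite hyper_paramK.
Qed.

End Separation.

(** * Compactness of convex partitions *)

Section Compactness.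
Variable R : realType.

Lemma convex_partition_locally_constant d M (Q : quantizer R d M)
    (a : 'I_M -> 'I_M -> d.-tuple R) (b : 'I_M -> 'I_M -> R) x :
  (forall i j, i != j -> [/\ nontriv (a i j) (b i j),
    (forall x, Q x = i -> dotp (a i j) x <= b i j)
    & (forall x, Q x = j -> b i j <= dotp (a i j) x)]) ->
  (forall i j, i != j -> ~ hyper (a i j) (b i j) x) ->
  exists2 e : R, 0 < e &
    forall y, (forall k, `|tnth y k - tnth x k| < e) -> Q y = Q x.
Proof.
move=> hab hx; pose i := Q x.
have H : \forall e \near 0^'+, forall j, i != j ->
    forall y, (forall k, `|tnth y k - tnth x k| < e) -> dotp (a i j) y < b i j.
  apply: filter_forall => j; have [ij|ij] := eqVneq i j; first by near=> e.
  have lt1 : 0 < b i j - dotp (a i j) x.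
    have [_ /(_ x erefl) le1 _] := hab _ _ ij.
    by rewrite subr_gt0 lt_neqAle le1 andbT; apply/eqP => /(hx _ _ ij).
  (* [dotp (a i j)] is [S]-Lipschitz for the sup norm; dividing by [1 + S] covers [S = 0]. *)
  pose S := \sum_k `|tnth (a i j) k|.
  have S0 : 0 <= S by apply: sumr_ge0.
  have S1 : 0 < 1 + S by rewrite ltr_pwDl.
  have q0 : 0 < (b i j - dotp (a i j) x) / (1 + S) by rewrite divr_gt0.
  near=> e => _ y hy.
  have e0 : 0 < e by [].
  have lee : e * (1 + S) < b i j - dotp (a i j) x by rewrite -ltr_pdivlMr.
  suff : dotp (a i j) y - dotp (a i j) x <= e * S by lra.
  rewrite /dotp -sumrB /S mulr_sumr; apply: ler_sum => k _.
  rewrite -mulrBr (le_trans (ler_norm _))// normrM mulrC ler_wpM2r//.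
  exact/ltW/hy.
have [e [e0 He]] : exists e : R, 0 < e /\ forall j, i != j ->
    forall y, (forall k, `|tnth y k - tnth x k| < e) -> dotp (a i j) y < b i j.
  have [e He] : exists e : R, (fun e => 0 < e /\ forall j, i != j ->
    forall y, (forall k, `|tnth y k - tnth x k| < e) -> dotp (a i j) y < b i j) e.
    apply: (@filter_ex _ (0^'+)); near=> e; split; first by [].
    by near: e.
  by exists e.
exists e => // y hy; apply: contrapT => /eqP Qyx.
have ij : i != Q y by rewrite eq_sym.
have [_ _ /(_ y erefl)] := hab _ _ ij.
by rewrite leNgt => /negP; apply; exact: He.
Unshelve. all: by end_near. Qed.

(** The sets of [n] giving each of the finitely many values cover [nat], so one of them is in the
    ultrafilter. *)
Lemma ultrafilter_limit (I : Type) (M : nat) (U : set_system nat) (Qn : nat -> I -> 'I_M) :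
  UltraFilter U -> exists Q : I -> 'I_M, forall x, U [set n | Qn n x = Q x].
Proof.
move=> UU; suff /choice[Q hQ] : forall x, exists q, U [set n | Qn n x = q] by exists Q.
move=> x; apply: contrapT => /forallNP H.
have : \forall n \near U, forall i, Qn n x <> i.
  apply: filter_forall => i.
  by have [/H|] := in_ultra_setVsetC [set n | Qn n x = i] UU.
by move=> /filter_ex[n /(_ (Qn n x))].
Qed.

(** The ultrafilter limit is only pointwise, so [r k] is chosen such that [Qn (r k)] agrees with [Q]
    at the first [k + 1] points of a countable list made of [x0] and the rational points. *)
Lemma convex_partition_compact d M (Qn : nat -> quantizer R d M) (x0 : d.-tuple R) :
  (forall n i, Defs.convex_set (Qn n @^-1` [set i])) ->
  exists (Q : quantizer R d M) (r : nat -> nat)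
    (a : 'I_M -> 'I_M -> d.-tuple R) (b : 'I_M -> 'I_M -> R),
  [/\ (forall i, Defs.convex_set (Q @^-1` [set i])), (forall k, (k <= r k)%N),
    (forall i j, i != j -> nontriv (a i j) (b i j)) &
    forall x, x = x0 \/ (forall i j, i != j -> ~ hyper (a i j) (b i j) x) ->
      \forall k \near \oo, Qn (r k) x = Q x].
Proof.
move=> cQn.
have [U [UU ooU]] := ultraFilterLemma (F := \oo).
have [Q hQ] := ultrafilter_limit Qn UU.
have cQ i : Defs.convex_set (Q @^-1` [set i]).
  move=> x y l /= Qx Qy l01.
  have [n [[h1 h2] h3]] := filter_ex (filterI (filterI (hQ x) (hQ y)) (hQ (tcomb l x y))).
  by rewrite -h3; apply: cQn => //=; rewrite ?h1 ?h2.
have [a [b hab]] := convex_partition_separation cQ.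
pose rpt (q : d.-tuple rat) : d.-tuple R := [tuple ratr (tnth q i) | i < d].
pose pt k := if k is k'.+1 then if unpickle k' is Some q then rpt q else x0 else x0.
have /choice[r hr] k : exists n, (k <= n)%N /\ forall j : 'I_k.+1, Qn n (pt j) = Q (pt j).
  have h1 : U [set n | (k <= n)%N] by apply: ooU; exact: nbhs_infty_ge.
  have h2 : \forall n \near U, forall j : 'I_k.+1, Qn n (pt j) = Q (pt j).
    by apply: filter_forall => j; exact: hQ.
  by have [n [? ?]] := filter_ex (filterI h1 h2); exists n.
have rpt_cvg j : \forall k \near \oo, Qn (r k) (pt j) = Q (pt j).
  exists j => // k /= jk; have [_ H] := hr k.
  by have jk' : (j < k.+1)%N by []; exact: (H (Ordinal jk')).
exists Q, r, a, b; split => //.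
- by move=> k; have [] := hr k.
- by move=> i j /hab[].
move=> x [->|hx]; first exact: (rpt_cvg 0%N).
have [e e0 He] := convex_partition_locally_constant hab hx.
(* Induction on the number [m] of leading coordinates that [y] shares with [x], the remaining ones
   being rational; all points stay in the box where [Q] is constant. *)
suff H m : (m <= d)%N -> forall y : d.-tuple R, (forall k, `|tnth y k - tnth x k| < e) ->
    (forall k : 'I_d, (k < m)%N -> tnth y k = tnth x k) ->
    (forall k : 'I_d, (m <= k)%N -> exists q, tnth y k = ratr q) ->
    \forall k \near \oo, Qn (r k) y = Q x.
  apply: (H d) => // k; first by rewrite subrr normr0.
  by rewrite leqNgt ltn_ord.
elim: m => [_ y ye _ yq|m IH md y ye ylt yge].
  have /choice[q {}yq] : forall k, exists q, tnth y k = ratr q by move=> k; exact: yq.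
  have yE : y = pt (pickle [tuple q i | i < d]).+1.
    by rewrite /pt pickleK; apply/eq_from_tnth => i; rewrite !tnth_mktuple -yq.
  by have := rpt_cvg (pickle [tuple q i | i < d]).+1; rewrite -yE (He y).
pose im := Ordinal md; pose xm := tnth x im.
(* The coordinate [xm] is bracketed by two rationals within [e]: [y] lies on the segment between two
   points already treated, and the cells of [Qn (r k)] are convex. *)
have [q1] := @rat_in_itvoo R (xm - e) xm ltac:(by rewrite ltrBlDr ltrDl).
have [q2] := @rat_in_itvoo R xm (xm + e) ltac:(by rewrite ltrDl).
rewrite !in_itv /= => /andP[q2l q2u] /andP[q1l q1u].
pose yy (q : rat) : d.-tuple R := [tuple if k == im then ratr q else tnth y k | k < d].
have yyE q k : tnth (yy q) k = if k == im then ratr q else tnth y k.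
  by rewrite tnth_mktuple.
have Hyy q : `|ratr q - xm| < e -> \forall k \near \oo, Qn (r k) (yy q) = Q x.
  move=> qe; apply: IH => [|k|k km|k mk]; first exact: ltnW.
  - by rewrite yyE; case: eqP => [->|_].
  - rewrite yyE; case: eqP => [kE|_]; first by move: km; rewrite kE ltnn.
    by apply: ylt; rewrite ltnS ltnW.
  - rewrite yyE; case: eqP => [kE|/eqP kE]; first by exists q.
    apply: yge; rewrite ltn_neqAle mk andbT; apply: contra kE => /eqP mk'.
    by apply/eqP/val_inj; rewrite /= mk'.
have H1 : \forall k \near \oo, Qn (r k) (yy q1) = Q x.
  by apply: Hyy; rewrite ltr_norml; apply/andP; split; lra.
have H2 : \forall k \near \oo, Qn (r k) (yy q2) = Q x.
  by apply: Hyy; rewrite ltr_norml; apply/andP; split; lra.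
have q12 : ratr q1 < ratr q2 :> R by exact: lt_trans q1u q2l.
have d0 : 0 < ratr q2 - ratr q1 :> R by rewrite subr_gt0.
pose l : R := (ratr q2 - xm) / (ratr q2 - ratr q1).
have l01 : 0 <= l <= 1.
  by rewrite /l divr_ge0 ?subr_ge0 ?(ltW q2l) ?(ltW q12)//= ler_pdivrMr// mul1r lerD2l lerN2 ltW.
have yl : y = tcomb l (yy q1) (yy q2).
  apply/eq_from_tnth => k; rewrite tcomb_tnth !yyE; case: eqP => [->|_]; last by ring.
  by rewrite ylt//= -/xm /l; field; rewrite gt_eqF.
near=> k; rewrite yl; apply: (cQn (r k) (Q x)) => //=.
- by near: k.
- by near: k.
Unshelve. all: by end_near. Qed.

End Compactness.

(** * Iterated Lebesgue integrals *)

Section IteratedIntegral.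
Variable R : realType.
Local Notation leb := (@lebesgue_measure R).

Lemma tdel_cons n x (t : n.-tuple R) : tdel ord0 (cons_tuple x t) = t.
Proof. by apply/eq_from_tnth => i; rewrite tnth_mktuple tnthS. Qed.

Lemma iint_ge0 n (G : n.-tuple R -> \bar R) : (forall z, 0 <= G z)%E -> (0 <= iint G)%E.
Proof.
elim: n G => [|n IH] G G0 /=; first exact: G0.
by apply: integral_ge0 => x _; apply: IH.
Qed.

Lemma iint_eq n (G H : n.-tuple R -> \bar R) : G =1 H -> iint G = iint H.
Proof. by move=> /funext ->. Qed.

(** The integral of a nonnegative function is a supremum over the simple functions below it, hence
    monotone for arbitrary integrands such as the slices in [iint_mono]. *)
Lemma ge0_le_integral_nomeas d (T : measurableType d) (mu : {measure set T -> \bar R})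
    (D : set T) (f g : T -> \bar R) :
  (forall x, D x -> 0 <= f x)%E -> (forall x, D x -> f x <= g x)%E ->
  (\int[mu]_(x in D) f x <= \int[mu]_(x in D) g x)%E.
Proof.
move=> f0 fg; rewrite !ge0_integralE//; last by move=> x Dx; apply: le_trans (fg _ Dx); exact: f0.
apply: le_ereal_sup => _ [h hf <-]; exists h => //= x.
apply: le_trans (hf x) _; rewrite !patchE; case: ifPn => // /[!inE]; exact: fg.
Qed.

Lemma iint_mono n (G H : n.-tuple R -> \bar R) :
  (forall z, 0 <= G z)%E -> (forall z, G z <= H z)%E -> (iint G <= iint H)%E.
Proof.
elim: n G H => [|n IH] G H G0 GH /=; first exact: GH.
by apply: ge0_le_integral_nomeas => x _; [exact: iint_ge0|exact: IH].
Qed.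

(** Fixing the first coordinate leaves a hyperplane of one dimension less, nontrivial for all but at
    most one value of that coordinate. *)
Lemma iint_hyper0 n (a : n.-tuple R) b (G : n.-tuple R -> \bar R) :
  nontriv a b -> (forall z, ~ hyper a b z -> G z = 0%E) -> iint G = 0%E.
Proof.
elim: n a b G => [|n IH] a b G nab G0 /=.
  case: nab => [[[]//]|b0]; apply: G0; rewrite /hyper /= /dotp big_ord0.
  by move=> /esym/eqP; apply/negP.
have hE x t : hyper a b (cons_tuple x t) <-> hyper (tdel ord0 a) (b - tnth a ord0 * x) t.
  rewrite /hyper /= (dotp_tdel ord0) tdel_cons tnth0.
  by split => [<-|->]; ring.
have IH' x : nontriv (tdel ord0 a) (b - tnth a ord0 * x) -> iint (fun t => G (cons_tuple x t)) = 0%E.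
  by move=> nt; apply: (IH _ _ _ nt) => t ht; apply: G0 => /hE.
pose c := b / tnth a ord0.
pose v := iint (fun t : n.-tuple R => G (cons_tuple c t)).
rewrite (_ : (fun x => _) = cst v \_ [set c]); last first.
  apply/funext => x; rewrite patchE; case: ifPn => [/[!inE]/= ->//|].
  rewrite notin_setE /= => xc; apply: IH'; apply: contrapT => /not_orP[h1 /negP].
  rewrite negbK subr_eq0 => /eqP h2; case: nab => [[k ak]|b0].
    case: (unliftP ord0 k) => [j kE|kE]; last first.
      by rewrite kE in ak; apply: xc; rewrite /c h2 mulrC mulKf.
    by apply: h1; exists j; rewrite tnth_mktuple -kE.
  apply: xc; rewrite /c h2 mulrC mulKf//; apply: contra b0 => /eqP a0.
  by rewrite h2 a0 mul0r.
rewrite -(@integral_mkcond _ _ _ leb [set c]) integral_cst//.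
by rewrite /= lebesgue_measure_set1 mule0.
Qed.

Definition cube n (z : n.-tuple R) (e : R) : set (n.-tuple R) :=
  [set y | forall i, tnth z i < tnth y i < tnth z i + e].

Lemma iint_cube n (z : n.-tuple R) (e c : R) : 0 < e ->
  iint (fun y => (\1_(cube z e) y * c)%:E) = (e ^+ n * c)%:E.
Proof.
move=> e0; elim: n z => [|n IH] z /=.
  by rewrite expr0 indicE mem_set// => -[].
rewrite (_ : (fun x => _) = cst (e ^+ n * c)%:E \_ `]tnth z ord0, tnth z ord0 + e[).
  rewrite -(@integral_mkcond _ _ _ leb) integral_cst; last exact: measurable_itv.
  rewrite /= lebesgue_measure_itv /= lte_fin ltrDl e0 -EFinB -EFinM; congr EFin.
  by rewrite exprS; ring.
apply/funext => x; rewrite patchE.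
have cE t : cube z e (cons_tuple x t) <->
    `]tnth z ord0, tnth z ord0 + e[%classic x /\ cube (tdel ord0 z) e t.
  rewrite /= in_itv /=; split=> [H|[H1 H2] i].
    split; first by have := H ord0; rewrite tnth0.
    by move=> i; have := H (lift ord0 i); rewrite tnthS tnth_mktuple.
  case: (unliftP ord0 i) => [j|] ->; last by rewrite tnth0.
  by have := H2 j; rewrite tnthS tnth_mktuple.
case: ifPn => [/set_mem xI|/negP xI].
  rewrite -(IH (tdel ord0 z)); apply: iint_eq => t; congr (_ * _)%:E.
  rewrite !indicE; congr (_%:R); congr nat_of_bool.
  by apply/idP/idP => /set_mem H; apply/mem_set; [case/cE: H|apply/cE].
rewrite -[RHS](_ : iint (fun _ : n.-tuple R => 0%E) = 0%E).
  apply: iint_eq => t; rewrite indicE memNset ?mul0r//.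
  by move=> /cE[/mem_set].
elim: n {z IH xI cE} => //= n ->; exact: integral0.
Qed.

(** The parameter space is arbitrary so that the induction can move the first coordinate into it. *)
Lemma measurable_iint n d (Y : measurableType d) (G : n.-tuple R -> Y -> \bar R) :
  measurable_fun setT (fun p => G p.1 p.2) -> (forall z y, 0 <= G z y)%E ->
  measurable_fun setT (fun y => iint (fun z => G z y)).
Proof.
elim: n d Y G => [|n IH] d Y G mG G0 /=.
  apply: (@measurableT_comp _ _ _ _ _ _ (fun p => G p.1 p.2) _
    (fun y => ([tuple] : 0.-tuple R, y))) => //.
  exact/measurable_fun_pair.
pose F (p : R * Y) := iint (fun t : n.-tuple R => G (cons_tuple p.1 t) p.2).
have mF : measurable_fun setT F.
  apply: (IH _ _ (fun t (p : R * Y) => G (cons_tuple p.1 t) p.2)) => [|z y]; last exact: G0.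
  pose h (p : n.-tuple R * (R * Y)) := (cons_tuple p.2.1 p.1, p.2.2).
  apply: (@measurableT_comp _ _ _ _ _ _ (fun p => G p.1 p.2) _ h) => //.
  apply/measurable_fun_pair => /=.
    by apply: measurable_cons => //; exact: (measurableT_comp measurable_fst measurable_snd).
  exact: (measurableT_comp measurable_snd measurable_snd).
apply: (@measurable_fun_fubini_tonelli_G _ _ _ _ R leb F) => // p.
exact: iint_ge0.
Qed.

Lemma iint_tonelli n d (Y : measurableType d) (P : {sigma_finite_measure set Y -> \bar R})
    (G : n.-tuple R -> Y -> \bar R) :
  measurable_fun setT (fun p => G p.1 p.2) -> (forall z y, 0 <= G z y)%E ->
  iint (fun z => \int[P]_y G z y)%E = (\int[P]_y iint (fun z => G z y))%E.
Proof.
elim: n G => [|n IH] G mG G0 //=.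
pose F (p : R * Y) := iint (fun t : n.-tuple R => G (cons_tuple p.1 t) p.2).
have mF : measurable_fun setT F.
  apply: (@measurable_iint _ _ _ (fun t (p : R * Y) => G (cons_tuple p.1 t) p.2)) => [|z y]; last exact: G0.
  pose h (p : n.-tuple R * (R * Y)) := (cons_tuple p.2.1 p.1, p.2.2).
  apply: (@measurableT_comp _ _ _ _ _ _ (fun p => G p.1 p.2) _ h) => //.
  apply/measurable_fun_pair => /=.
    by apply: measurable_cons => //; exact: (measurableT_comp measurable_fst measurable_snd).
  exact: (measurableT_comp measurable_snd measurable_snd).
transitivity (\int[leb]_x \int[P]_y F (x, y))%E.
  apply: eq_integral => x _; apply: IH => //.
  pose h (p : n.-tuple R * Y) := (cons_tuple x p.1, p.2).
  apply: (@measurableT_comp _ _ _ _ _ _ (fun p => G p.1 p.2) _ h) => //.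
  by apply/measurable_fun_pair => //=; apply: measurable_cons.
apply: fubini_tonelli => // p; exact: iint_ge0.
Qed.

End IteratedIntegral.

(** * The transition kernel and the belief update *)

Lemma ge0_integral_mrestr d (T : measurableType d) (R : realType)
    (mu : {measure set T -> \bar R}) (D : set T) (mD : measurable D) (g : T -> \bar R) :
  measurable_fun setT g -> (forall x, 0 <= g x)%E ->
  (\int[mrestr mu mD]_x g x = \int[mu]_(x in D) g x)%E.
Proof.
move=> mg g0; rewrite -(setUv D) ge0_integral_setU//; last 3 first.
- exact: measurableC.
- by rewrite setUv.
- by apply/disj_set2P; rewrite setICr.
rewrite [X in (_ + X)%E](_ : _ = 0%E) ?adde0.
  by apply: eq_measure_integral => A mA AD; rewrite /= /mrestr; congr (mu _); exact/setIidl.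
rewrite -[RHS](integral_measure_zero (~` D) g); apply: eq_measure_integral => A mA AD.
by rewrite /= /mrestr (_ : A `&` D = set0) ?measure0//; exact/disjoints_subset.
Qed.

Section Dynamics.
Variables (R : realType) (d : nat).
Local Notation Rd := (d.-tuple R).
Variable f : Rd -> Rd -> Rd.
Hypothesis hf : measurable_fun [set: Rd * Rd] (fun p : Rd * Rd => f p.1 p.2).
Variable nu : probability Rd R.
Variables (phi : Rd -> Rd -> R) (C1 : R).
Hypothesis phi_dens : forall (x : Rd) (A : set Rd), measurable A ->
  nu [set w | A (f x w)] = iint (fun z => (\1_A z * phi z x)%:E).
Hypothesis phi_ge0 : forall z x, 0 <= phi z x.
Hypothesis phi_lip : forall z z' x, `|phi z x - phi z' x| <= C1 * tnorm (tsub z z').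

Lemma measurable_fx x : measurable_fun setT (f x).
Proof.
apply: (@measurableT_comp _ _ _ _ _ _ (fun p : Rd * Rd => f p.1 p.2) _ (fun w => (x, w))) => //.
exact/measurable_fun_pair.
Qed.

Lemma tnorm_cube (z y : Rd) e : cube z e y -> tnorm (tsub y z) <= Num.sqrt (d%:R) * e.
Proof.
move=> H.
have [d0|d0] := posnP d.
  rewrite /tnorm /tsqnorm big1 ?sqrtr0 => [|i _]; last by have := ltn_ord i; rewrite {2}d0.
  by rewrite (_ : Num.sqrt (d%:R) = 0) ?mul0r// d0 sqrtr0.
have e0 : 0 < e by have /andP[h1 h2] := H (Ordinal d0); have := lt_trans h1 h2; rewrite ltrDl.
rewrite -[e in leRHS]ger0_norm ?(ltW e0)// -sqrtr_sqr -sqrtrM// ler_wsqrtr//.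
rewrite -[d in leRHS]card_ord -sum1_card natr_sum mulr_suml; apply: ler_sum => i _.
rewrite tnth_mktuple mul1r; have /andP[h1 h2] := H i.
by rewrite ler_pXn2r// ?nnegrE; lra.
Qed.

(** On the cube the density differs from its value at the corner by at most the Lipschitz constant
    times the diameter; comparison with constant densities bounds the mass. *)
Lemma density_cube_approx z x e : 0 < e ->
  `|fine (nu [set w | cube z e (f x w)]) / e ^+ d - phi z x| <= (`|C1| * Num.sqrt d%:R) * e.
Proof.
move=> e0; set L := _ * Num.sqrt _.
have mc : measurable (cube z e).
  rewrite (_ : cube z e = \bigcap_(i in [set: 'I_d]) (setT `&` (fun y : Rd => tnth y i) @^-1` `]tnth z i, tnth z i + e[)).
    apply: fin_bigcap_measurable => [|i _]; first exact: finite_finset.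
    exact: (measurable_tnth i).
  by apply/seteqP; split => y /= H i; [move=> _; split => //=; rewrite in_itv/=; exact: H|have [//|_] := H i; rewrite /= in_itv].
have lip y : cube z e y -> `|phi y x - phi z x| <= L * e.
  move=> cy; apply: le_trans (phi_lip _ _ _) _.
  (* The sign of [C1] is not known, whence the absolute value. *)
  rewrite /L -mulrA; apply: le_trans (_ : `|C1| * tnorm (tsub y z) <= _).
    by rewrite ler_wpM2r ?sqrtr_ge0// ler_norm.
  by rewrite ler_wpM2l// tnorm_cube.
set n := nu _.
have nfin : n \is a fin_num by apply: fin_num_measure; rewrite -[X in measurable X]setTI; exact: measurable_fx.
have L0 : 0 <= L by rewrite mulr_ge0 ?sqrtr_ge0.
have ed : 0 < e ^+ d by rewrite exprn_gt0.
have up : fine n <= e ^+ d * (phi z x + L * e).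
  rewrite -lee_fin fineK// /n phi_dens// -(iint_cube z)//.
  apply: iint_mono => y; rewrite lee_fin; first by rewrite mulr_ge0.
  rewrite indicE; case: (boolP (y \in _)) => [/set_mem/lip|_]; last by rewrite !mul0r.
  by rewrite !mul1r ler_norml => /andP[_]; lra.
have lo : e ^+ d * (phi z x - L * e) <= fine n.
  (* Truncation at 0 keeps the minorant nonnegative, as [iint_mono] demands. *)
  apply: le_trans (_ : e ^+ d * Num.max 0 (phi z x - L * e) <= _).
    by rewrite ler_wpM2l ?(ltW ed)// le_max lexx orbT.
  rewrite -lee_fin fineK// /n phi_dens// -(iint_cube z)//.
  apply: iint_mono => y; rewrite lee_fin; first by rewrite mulr_ge0// le_max lexx.
  rewrite indicE; case: (boolP (y \in _)) => [/set_mem/lip|_]; last by rewrite !mul0r.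
  rewrite !mul1r ler_norml => /andP[h _]; rewrite ge_max phi_ge0/=; lra.
have lo' : phi z x - L * e <= fine n / e ^+ d by rewrite ler_pdivlMr// mulrC.
have up' : fine n / e ^+ d <= phi z x + L * e by rewrite ler_pdivrMr// mulrC.
by rewrite ler_norml; apply/andP; split; lra.
Qed.

(* The density is the limit of the normalized kernel masses of small cubes, which are
   jointly measurable in the corner of the cube and the state. *)
Lemma measurable_density : measurable_fun [set: Rd * Rd] (fun p => phi p.1 p.2).
Proof.
pose h n (p : Rd * Rd) := fine (nu [set w | cube p.1 n.+1%:R^-1 (f p.2 w)]) / (n.+1%:R^-1) ^+ d.
apply: (@measurable_fun_cvg _ _ _ _ h) => [n|[z x] _] /=.
  apply: measurable_funM => //; apply: measurableT_comp => //.
  set e := n.+1%:R^-1.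
  have mB : measurable [set q : (Rd * Rd) * Rd | cube q.1.1 e (f q.1.2 q.2)].
    rewrite (_ : mkset _ = \bigcap_(i in [set: 'I_d])
        ((setT `&` (fun q : (Rd * Rd) * Rd => tnth (f q.1.2 q.2) i - tnth q.1.1 i) @^-1` `]0, e[))).
      apply: fin_bigcap_measurable => [|i _]; first exact: finite_finset.
      apply: (_ : measurable_fun setT _) => //; apply: measurable_funB.
        apply: (@measurableT_comp _ _ _ _ _ _ (fun y : Rd => tnth y i) _
          (fun q : (Rd * Rd) * Rd => f q.1.2 q.2)); first exact: measurable_tnth.
        apply: (@measurableT_comp _ _ _ _ _ _ (fun p : Rd * Rd => f p.1 p.2) _
          (fun q : (Rd * Rd) * Rd => (q.1.2, q.2))) => //.
        apply/measurable_fun_pair => //=.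
        exact: (measurableT_comp measurable_snd measurable_fst).
      apply: (@measurableT_comp _ _ _ _ _ _ (fun y : Rd => tnth y i) _
          (fun q : (Rd * Rd) * Rd => q.1.1)); first exact: measurable_tnth.
      exact: (measurableT_comp measurable_fst measurable_fst).
    apply/seteqP; split => q /= H i.
      by move=> _; split => //=; rewrite in_itv/=; have := H i; rewrite subr_gt0 ltrBlDl.
    by have [//|_] := H i; rewrite /= in_itv/= subr_gt0 ltrBlDl.
  have := measurable_fun_xsection nu mB; congr measurable_fun.
  apply/funext => p /=; congr (nu _); apply/seteqP; split => w /=; rewrite /xsection /=.
    by rewrite inE.
  by move=> H; rewrite inE.
apply/cvgrPdist_le => eps eps0.
set L := `|C1| * Num.sqrt d%:R.
have L0 : 0 < 1 + L by rewrite ltr_pwDl// mulr_ge0 ?sqrtr_ge0.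
near=> n; rewrite distrC.
apply: le_trans (density_cube_approx z x _) _; first by rewrite invr_gt0.
rewrite -/L ler_pdivrMr//.
have : (1 + L) / eps <= n%:R by near: n; exact: nbhs_infty_ger.
by rewrite ler_pdivrMr// => hn; rewrite -natr1; nra.
Unshelve. all: by end_near. Qed.

End Dynamics.

(** The Bayes update without densities: the conditional expectation of [h] at the next state, given
    the cell of the current one. All later arguments use the update in this form. *)
Definition kernel_update (R : realType) d M (f : d.-tuple R -> d.-tuple R -> d.-tuple R)
    (nu : probability (d.-tuple R) R) (upd : belief_update R d M) :=
  forall m (P : probability (d.-tuple R) R) (Q : quantizer R d M) (h : d.-tuple R -> \bar R),
  Qc Q -> (0 < P (Q @^-1` [set m]))%E -> measurable_fun setT h -> (forall z, 0 <= h z)%E ->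
  (\int[upd m P Q]_z h z = (fine (P (Q @^-1` [set m])))^-1%:E *
    \int[P]_(x in Q @^-1` [set m]) \int[nu]_w h (f x w))%E.

Section BeliefUpdate.
Variables (R : realType) (d M : nat).
Local Notation Rd := (d.-tuple R).
Variable f : Rd -> Rd -> Rd.
Hypothesis hf : measurable_fun [set: Rd * Rd] (fun p : Rd * Rd => f p.1 p.2).
Variable nu : probability Rd R.
Variables (phi : Rd -> Rd -> R) (C1 : R).
Hypothesis phi_dens : forall (x : Rd) (A : set Rd), measurable A ->
  nu [set w | A (f x w)] = iint (fun z => (\1_A z * phi z x)%:E).
Hypothesis phi_ge0 : forall z x, 0 <= phi z x.
Hypothesis phi_lip : forall z z' x, `|phi z x - phi z' x| <= C1 * tnorm (tsub z z').
Variable upd : belief_update R d M.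
Hypothesis hupd : is_belief_update phi upd.

(** Tonelli exchanges the Lebesgue integral in the next state and the integral over the cell;
    [measurable_density] supplies the joint measurability. *)
Lemma upd_kernel m (P : probability Rd R) Q A :
  Qc Q -> (0 < P (Q @^-1` [set m]))%E -> measurable A ->
  upd m P Q A = ((fine (P (Q @^-1` [set m])))^-1%:E *
    \int[P]_(x in Q @^-1` [set m]) nu [set w | A (f x w)])%E.
Proof.
move=> QQ P0 mA; rewrite hupd//; congr (_ * _)%E.
set D := Q @^-1` [set m]; have mD : measurable D by have [] := QQ m.
have mphi := measurable_density hf phi_dens phi_ge0 phi_lip.
pose G z x := ((\1_A z * phi z x) * \1_D x)%:E.
have G0 z x : (0 <= G z x)%E by rewrite lee_fin !mulr_ge0.
have mG : measurable_fun setT (fun p : Rd * Rd => G p.1 p.2).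
  apply/measurable_EFinP; apply: measurable_funM; first apply: measurable_funM => //.
    exact: (measurableT_comp (measurable_indic mA) measurable_fst).
  exact: (measurableT_comp (measurable_indic mD) measurable_snd).
transitivity (iint (fun z => \int[P]_x G z x)%E).
  apply: iint_eq => z; rewrite -ge0_integralZl//.
  - rewrite integral_mkcond; apply: eq_integral => x _.
    rewrite patchE /G !indicE; case: ifPn => _; last by rewrite mulr0.
    by rewrite mulr1 EFinM.
  - apply/measurable_EFinP; apply: measurable_funTS.
    apply: (@measurableT_comp _ _ _ _ _ _ (fun p : Rd * Rd => phi p.1 p.2) _ (fun x => (z, x))) => //.
    exact/measurable_fun_pair.
  - by move=> x _; rewrite lee_fin.
rewrite iint_tonelli// [RHS]integral_mkcond; apply: eq_integral => x _.
rewrite patchE /G [\1_D x]indicE; case: ifPn => _.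
  by rewrite phi_dens//; apply: iint_eq => z; rewrite mulr1.
apply/eqP; rewrite eq_le iint_ge0 ?andbT; last by move=> z; rewrite mulr0.
have -> : (point : \bar R) = 0%E by [].
(* The case [c = 0] of [iint_cube] gives the integral of the zero function. *)
have := @iint_cube R d [tuple 0 | _ < d] 1 0 ltr01; rewrite mulr0 -[0%:E]/0%E => <-.
by apply: iint_mono => z; rewrite !mulr0.
Qed.

(** The updated belief is the image under [f] of [P \x nu] restricted to the cell and normalized;
    equality on events then passes to nonnegative functions. *)
Lemma upd_integral : kernel_update f nu upd.
Proof.
move=> m P Q h QQ P0 mh h0.
set D := Q @^-1` [set m] in P0 *; have mD : measurable D by have [] := QQ m.
set c := (fine _)^-1.
have c0 : 0 <= c by rewrite invr_ge0 fine_ge0.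
pose F (p : Rd * Rd) := f p.1 p.2.
have mDT : measurable (D `*` [set: Rd]) by exact: measurableX.
have restrE (g : Rd * Rd -> \bar R) : measurable_fun setT g -> (forall p, 0 <= g p)%E ->
    (\int[(P \x nu)%E]_(p in D `*` setT) g p = \int[P]_(x in D) \int[nu]_w g (x, w))%E.
  move=> mg g0; rewrite integral_mkcond fubini_tonelli1; last 2 first.
  - by apply/(measurable_restrictT _ _).1 => //; exact: measurable_funTS.
  - by move=> p; apply: erestrict_ge0.
  rewrite [RHS]integral_mkcond; apply: eq_integral => x _.
  rewrite /fubini_F !patchE; case: ifPn => [/set_mem xD|/negP xD].
    by apply: eq_integral => w _; rewrite patchE mem_set.
  rewrite -[RHS](@integral0 _ _ _ nu setT); apply: eq_integral => w _.
  by rewrite patchE memNset// => -[/= /mem_set].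
pose m2 := mscale (NngNum c0) (mrestr (P \x nu)%E mDT).
transitivity (\int[pushforward m2 F]_z h z)%E.
  apply: eq_measure_integral => A mA _.
  apply: etrans (upd_kernel QQ P0 mA) _; rewrite /= /pushforward /m2 /mscale/= /mrestr; congr (_ * _)%E.
  have mFA : measurable (F @^-1` A) by rewrite -[X in measurable X]setTI; exact: hf.
  rewrite [LHS]integral_mkcond /product_measure1; apply: eq_integral => x _ /=.
  rewrite patchE; case: ifPn => [/set_mem xD|/negP xD].
    congr (nu _); apply/seteqP; split => w /=; rewrite /xsection /=.
      by move=> Aw; rewrite inE.
    by rewrite inE => -[].
  rewrite (_ : xsection _ x = set0) ?measure0//; apply/seteqP; split => w //=.
  by rewrite /xsection /= inE => -[_ [/= /mem_set]].
have mhF : measurable_fun setT (h \o F) by exact: measurableT_comp.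
rewrite ge0_integral_pushforward//= preimage_setT ge0_integral_mscale//; congr (_ * _)%E.
by rewrite ge0_integral_mrestr// restrE.
Qed.

End BeliefUpdate.

(** * Quadratic weight and second moments *)

Section Convergence.
Variables (R : realType) (d M : nat).
Local Notation Rd := (d.-tuple R).

Definition wt (x : Rd) : R := 1 + tsqnorm x.

Definition fin2 (P : probability Rd R) := (\int[P]_x (tsqnorm x)%:E < +oo)%E.

Lemma tsqnorm_ge0 (x : Rd) : 0 <= tsqnorm x.
Proof. by apply: sumr_ge0 => i _; rewrite sqr_ge0. Qed.

Lemma measurable_tsqnorm : measurable_fun setT (@tsqnorm R d).
Proof.
apply: measurable_sum => i; apply: measurable_funX; exact: measurable_tnth.
Qed.

Lemma measurable_wt : measurable_fun setT wt.
Proof. by apply: measurable_funD => //; exact: measurable_tsqnorm. Qed.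

Lemma wt_ge1 x : 1 <= wt x.
Proof. by rewrite lerDl tsqnorm_ge0. Qed.

Lemma wt_ge0 x : 0 <= wt x.
Proof. exact: le_trans (wt_ge1 x). Qed.

Lemma integral_wt (P : probability Rd R) :
  (\int[P]_x (wt x)%:E = 1 + \int[P]_x (tsqnorm x)%:E)%E.
Proof.
rewrite (_ : (fun x => (wt x)%:E) = (fun x => (1%:E + (tsqnorm x)%:E)%E)) //.
rewrite ge0_integralD//.
- congr (_ + _)%E; apply: etrans (integral_cst _ _ _) _ => //.
  by rewrite mul1e; exact: probability_setT.
- by move=> x _; rewrite lee_fin tsqnorm_ge0.
- by apply/measurable_EFinP; exact: measurable_tsqnorm.
Qed.

Lemma fin2_integrable (P : probability Rd R) c : fin2 P ->
  P.-integrable setT (fun x => (c * wt x)%:E).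
Proof.
move=> fP; rewrite (_ : (fun x => _) = (fun x => (c%:E * (wt x)%:E)%E))//.
apply: integrableZl => //; apply/integrableP; split.
  by apply/measurable_EFinP; exact: measurable_wt.
under eq_integral do rewrite gee0_abs ?lee_fin ?wt_ge0//.
by rewrite integral_wt lte_add_pinfty// ltry.
Qed.

End Convergence.

(** * Convergence of beliefs *)

Lemma near_subseq (s : nat -> nat) (P : nat -> Prop) : (forall k, (k <= s k)%N) ->
  (\forall n \near \oo, P n) -> \forall k \near \oo, P (s k).
Proof.
by move=> hs [N _ H]; exists N => // k /= Nk; apply: H; exact: leq_trans (hs k).
Qed.

Section BeliefConvergence.
Variables (R : realType) (d M : nat).
Local Notation Rd := (d.-tuple R).
Local Notation proba := (probability Rd R).
Variable f : Rd -> Rd -> Rd.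
Hypothesis hf : measurable_fun [set: Rd * Rd] (fun p : Rd * Rd => f p.1 p.2).
Variable nu : proba.
Variable upd : belief_update R d M.
Hypothesis updE : kernel_update f nu upd.
Variable c2 : R.
Hypothesis kernel_wt : forall x, (\int[nu]_w (wt (f x w))%:E <= (c2 * wt x)%:E)%E.

(** Nullity under every transition law: any updated belief then ignores [N], whatever the belief
    before it. *)
Definition kernel_null (N : set Rd) :=
  measurable N /\ forall x, nu [set w | N (f x w)] = 0%E.

(* The quantification over [s] makes the notion stable under subsequences. *)
Definition belief_cvg (Pn : nat -> proba) (P : proba) :=
  forall (s : nat -> nat) (h_ : nat -> Rd -> R) (h : Rd -> R) (c : R) (N : set Rd),
    (forall k, (k <= s k)%N) ->
    (forall k, measurable_fun setT (h_ k)) -> measurable_fun setT h ->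
    (forall k x, 0 <= h_ k x <= c * wt x) -> (forall x, 0 <= h x <= c * wt x) ->
    kernel_null N -> P N = 0%E -> (forall x, ~ N x -> h_ ^~ x @ \oo --> h x) ->
    (\int[Pn (s k)]_x (h_ k x)%:E)%E @[k --> \oo] --> (\int[P]_x (h x)%:E)%E.

Lemma belief_cvg_sub Pn P (s : nat -> nat) : (forall k, (k <= s k)%N) ->
  belief_cvg Pn P -> belief_cvg (Pn \o s) P.
Proof.
move=> hs cP s' h_ h c N hs'; apply: (cP (s \o s')) => k /=.
exact: leq_trans (hs' k) (hs _).
Qed.

Lemma integral_dominated (P : proba) (h : Rd -> R) c : fin2 P -> measurable_fun setT h ->
  (forall x, `|h x| <= c * wt x) -> P.-integrable setT (fun x => (h x)%:E).
Proof.
move=> fP mh hh; apply: le_integrable (fin2_integrable c fP) => //.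
  exact/measurable_EFinP.
by move=> x _ /=; rewrite lee_fin (le_trans (hh x))// ler_norm.
Qed.

Lemma integral_dominated_fin (P : proba) (h : Rd -> R) c : fin2 P -> measurable_fun setT h ->
  (forall x, `|h x| <= c * wt x) -> (\int[P]_x (h x)%:E)%E \is a fin_num.
Proof. by move=> fP mh hh; apply: integrable_fin_num => //; apply: integral_dominated hh. Qed.

Lemma cvg_integral_dominated (P : proba) (h_ : nat -> Rd -> R) (h : Rd -> R) (g : Rd -> R) N :
  P.-integrable setT (fun x => (g x)%:E) ->
  (forall k, measurable_fun setT (h_ k)) -> measurable_fun setT h ->
  (forall k x, 0 <= h_ k x <= g x) -> measurable N -> P N = 0%E ->
  (forall x, ~ N x -> h_ ^~ x @ \oo --> h x) ->
  (\int[P]_x (h_ k x)%:E)%E @[k --> \oo] --> (\int[P]_x (h x)%:E)%E.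
Proof.
move=> ig mh_ mh hb mN PN hh.
have [] := @dominated_convergence _ _ _ P setT measurableT
  (fun k x => (h_ k x)%:E) (fun x => (h x)%:E) (fun x => (g x)%:E) => //.
- by move=> k; exact/measurable_EFinP.
- exact/measurable_EFinP.
- exists N; split => // x /=; apply: contra_notP => nN _.
  by apply/fine_cvgP; split; [exact: nearW|exact: hh].
- apply: aeW => x k _ /=; rewrite lee_fin.
  by have /andP[h0 hc] := hb k x; rewrite ger0_norm.
Qed.

Lemma belief_cvg_cst P : fin2 P -> belief_cvg (fun=> P) P.
Proof.
move=> fP s h_ h c N _ mh_ mh hb _ [mN _] PN hh.
exact: cvg_integral_dominated (fin2_integrable c fP) mh_ mh hb mN PN hh.
Qed.

Lemma kernel_integral_fin x (h : Rd -> R) c : measurable_fun setT h ->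
  (forall x, 0 <= h x <= c * wt x) ->
  (0 <= \int[nu]_w (h (f x w))%:E <= ((c * c2) * wt x)%:E)%E.
Proof.
move=> mh hb.
have c0 : 0 <= c.
  have /andP[h0 h1] := hb x; have := le_trans h0 h1.
  by rewrite pmulr_lge0//; apply: lt_le_trans (wt_ge1 x).
have mwt : measurable_fun setT (fun w => (wt (f x w))%:E).
  apply/measurable_EFinP; apply: measurableT_comp (measurable_fx hf x).
  exact: measurable_wt.
apply/andP; split.
  by apply: integral_ge0 => w _; rewrite lee_fin; have /andP[] := hb (f x w).
apply: (@le_trans _ _ (\int[nu]_w (c%:E * (wt (f x w))%:E))%E).
  apply: ge0_le_integral_nomeas => w _.
    by rewrite lee_fin; have /andP[] := hb (f x w).
  by rewrite -EFinM lee_fin; have /andP[] := hb (f x w).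
rewrite ge0_integralZl//; last by move=> w _; rewrite lee_fin wt_ge0.
by rewrite -mulrA EFinM; apply: lee_wpmul2l; rewrite ?lee_fin.
Qed.

Definition kernel_mean (h : Rd -> R) (x : Rd) : R := fine (\int[nu]_w (h (f x w))%:E)%E.

Lemma kernel_meanE x (h : Rd -> R) c : measurable_fun setT h ->
  (forall x, 0 <= h x <= c * wt x) ->
  (kernel_mean h x)%:E = (\int[nu]_w (h (f x w))%:E)%E.
Proof.
move=> mh hb; have /andP[h0 h1] := kernel_integral_fin x mh hb.
by rewrite fineK// ge0_fin_numE// (le_lt_trans h1)// ltry.
Qed.

Lemma kernel_mean_bound x (h : Rd -> R) c : measurable_fun setT h ->
  (forall x, 0 <= h x <= c * wt x) -> 0 <= kernel_mean h x <= c * c2 * wt x.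
Proof.
move=> mh hb; have := kernel_integral_fin x mh hb.
by rewrite -(kernel_meanE x mh hb) !lee_fin.
Qed.

Lemma measurable_kernel_mean (h : Rd -> R) : measurable_fun setT h ->
  (forall x, 0 <= h x) -> measurable_fun setT (kernel_mean h).
Proof.
move=> mh h0; apply: measurableT_comp => //.
apply: (@measurable_fun_fubini_tonelli_F _ _ _ _ _ nu (fun p : Rd * Rd => (h (f p.1 p.2))%:E)).
  by apply/measurable_EFinP; exact: measurableT_comp.
by move=> p; rewrite lee_fin.
Qed.

(** The exceptional set is null for the law of [f x w] at every [x], so after averaging convergence
    holds everywhere. *)
Lemma cvg_kernel_mean (x : Rd) (h_ : nat -> Rd -> R) (h : Rd -> R) c (N : set Rd) :
  (forall k, measurable_fun setT (h_ k)) -> measurable_fun setT h ->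
  (forall k x, 0 <= h_ k x <= c * wt x) -> (forall x, 0 <= h x <= c * wt x) ->
  kernel_null N -> (forall x, ~ N x -> h_ ^~ x @ \oo --> h x) ->
  kernel_mean (h_ k) x @[k --> \oo] --> kernel_mean h x.
Proof.
move=> mh_ mh hb_ hb [mN N0] hh.
have mfx := measurable_fx hf x.
have c0 : 0 <= c.
  have /andP[h0 h1] := hb x; have := le_trans h0 h1.
  by rewrite pmulr_lge0//; apply: lt_le_trans (wt_ge1 x).
apply: fine_cvg; rewrite (kernel_meanE x mh hb).
apply: (@cvg_integral_dominated nu _ _ (fun w => c * wt (f x w)) [set w | N (f x w)]).
- rewrite (_ : (fun w => _) = (fun w => (c%:E * (wt (f x w))%:E)%E))//.
  apply: integrableZl => //; apply/integrableP; split.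
    by apply/measurable_EFinP; apply: measurableT_comp => //; exact: measurable_wt.
  under eq_integral do rewrite gee0_abs ?lee_fin ?wt_ge0//.
  by rewrite (le_lt_trans (kernel_wt x))// ltry.
- by move=> k; exact: measurableT_comp.
- exact: measurableT_comp.
- by move=> k w; exact: hb_.
- by rewrite -[X in measurable X]setTI; exact: mfx.
- exact: N0.
- by move=> w nN; exact: hh.
Qed.

Lemma upd_mean m (P : proba) (Q : quantizer R d M) (h : Rd -> R) c :
  Qc Q -> (0 < P (Q @^-1` [set m]))%E -> measurable_fun setT h ->
  (forall x, 0 <= h x <= c * wt x) ->
  (\int[upd m P Q]_z (h z)%:E = (fine (P (Q @^-1` [set m])))^-1%:E *
    \int[P]_x (\1_(Q @^-1` [set m]) x * kernel_mean h x)%:E)%E.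
Proof.
move=> QQ P0 mh hb; rewrite updE//; last 2 first.
- exact/measurable_EFinP.
- by move=> z; rewrite lee_fin; have /andP[] := hb z.
congr (_ * _)%E; rewrite integral_mkcond; apply: eq_integral => x _.
rewrite patchE indicE; case: ifPn => _; last by rewrite mul0r.
by rewrite mul1r (kernel_meanE x mh hb).
Qed.

Lemma fin2_upd m (P : proba) (Q : quantizer R d M) :
  fin2 P -> Qc Q -> (0 < P (Q @^-1` [set m]))%E -> fin2 (upd m P Q).
Proof.
move=> fP QQ P0; have [mD _] := QQ m.
have hb (x : Rd) : 0 <= tsqnorm x <= 1 * wt x by rewrite tsqnorm_ge0 mul1r lerDr ler01.
have mh := @measurable_tsqnorm R d.
rewrite /fin2 (upd_mean QQ P0 mh hb).
have /fineK <- : (\int[P]_x (\1_(Q @^-1` [set m]) x * kernel_mean (@tsqnorm R d) x)%:E)%E \is a fin_num.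
  apply: (@integral_dominated_fin _ _ (1 * c2)) => //.
    apply: measurable_funM; first exact: measurable_indic.
    by apply: measurable_kernel_mean => // x; exact: tsqnorm_ge0.
  move=> x; have /andP[k0 k1] := kernel_mean_bound x mh hb.
  rewrite normrM (ger0_norm k0) indicE; case: (_ \in _); rewrite ?normr1 ?normr0 ?mul1r ?mul0r//.
    by rewrite mul1r in k1.
  by rewrite mul1r in k1; exact: le_trans k1.
by rewrite -EFinM ltry.
Qed.

Lemma upd_null m (P : proba) (Q : quantizer R d M) N :
  Qc Q -> (0 < P (Q @^-1` [set m]))%E -> kernel_null N -> upd m P Q N = 0%E.
Proof.
move=> QQ P0 [mN N0].
rewrite -[N]setIT -(integral_indic _ measurableT mN).
have mi : measurable_fun setT (fun x => (\1_N x : R)%:E).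
  by apply/measurable_EFinP; exact: measurable_indic.
rewrite (updE QQ P0 mi) => [|z]; last by rewrite lee_fin.
have mD : measurable (Q @^-1` [set m]) by have [] := QQ m.
rewrite (_ : (fun x => _) = cst 0%E) ?integral_cst ?mul0e ?mule0//.
apply/funext => x /=; rewrite -(N0 x) -[X in nu X]setIT -integral_indic//.
by rewrite -[X in measurable X]setTI; exact: (measurable_fx hf x).
Qed.

Lemma belief_cvg_cell m Pn P (Qn : nat -> quantizer R d M) Q N (s : nat -> nat) :
  belief_cvg Pn P -> (forall n, Qc (Qn n)) -> Qc Q ->
  kernel_null N -> P N = 0%E -> (forall x, ~ N x -> \forall n \near \oo, Qn n x = Q x) ->
  (forall k, (k <= s k)%N) ->
  Pn (s k) (Qn (s k) @^-1` [set m]) @[k --> \oo] --> P (Q @^-1` [set m]).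
Proof.
move=> cP QQn QQ kN PN hQ hs.
have mD : measurable (Q @^-1` [set m]) by have [] := QQ m.
have mDn n : measurable (Qn n @^-1` [set m]) by have [] := QQn n m.
rewrite -[X in _ --> X]/(P (Q @^-1` [set m])) -[Q @^-1` _]setIT -integral_indic//.
under eq_fun do rewrite -[Qn _ @^-1` _]setIT -integral_indic//.
have ind01 (D : set Rd) x : 0 <= (\1_D x : R) <= 1 * wt x.
  by rewrite mul1r indicE; case: (_ \in _); rewrite /= ?ler01 ?wt_ge1 ?wt_ge0 ?lexx.
apply: (cP s _ _ 1 N) => //.
- by move=> k; apply: (measurable_indic (mDn (s k))).
move=> x nN; apply: cvg_near_cst.
have := near_subseq hs (hQ _ nN); apply: filterS => k Qk.
by rewrite !indicE; congr (_%:R); congr nat_of_bool; apply/idP/idP => /set_mem /= h;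
  apply/mem_set => /=; rewrite -h Qk.
Qed.

(** Integrals against the updates are quotients: the numerators integrate a cell indicator times
    [kernel_mean], the denominators are cell masses with positive limit. *)
Lemma belief_cvg_upd m Pn P (Qn : nat -> quantizer R d M) Q N :
  belief_cvg Pn P -> fin2 P -> (forall n, Qc (Qn n)) -> Qc Q ->
  kernel_null N -> P N = 0%E -> (forall x, ~ N x -> \forall n \near \oo, Qn n x = Q x) ->
  (0 < P (Q @^-1` [set m]))%E ->
  belief_cvg (fun n => upd m (Pn n) (Qn n)) (upd m P Q).
Proof.
move=> cP fP QQn QQ kN PN hQ P0 s h_ h c N' hs mh_ mh hb_ hb kN' _ hh.
have mD : measurable (Q @^-1` [set m]) by have [] := QQ m.
have mDn n : measurable (Qn n @^-1` [set m]) by have [] := QQn n m.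
have cell := belief_cvg_cell (m := m) cP QQn QQ kN PN hQ hs.
pose p k := Pn (s k) (Qn (s k) @^-1` [set m]).
have Pfin : P (Q @^-1` [set m]) \is a fin_num by exact: fin_num_measure.
have near0 : \forall k \near \oo, (0 < p k)%E.
  have := cell; rewrite -(fineK Pfin) => /fine_cvgP[_ /cvgrPdist_lt].
  have fp0 : 0 < fine (P (Q @^-1` [set m])) by apply: fine_gt0; rewrite P0 ltey_eq Pfin.
  move=> /(_ _ fp0); apply: filterS => k; rewrite ltr_distlC => /andP[+ _].
  rewrite subrr => pk; rewrite lt_neqAle measure_ge0 andbT.
  by apply: contraTN pk => /eqP pk0; rewrite -leNgt /= -/(p k) -pk0.
have gb (D : set Rd) (h' : Rd -> R) : measurable_fun setT h' -> (forall x, 0 <= h' x <= c * wt x) ->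
    forall x, 0 <= \1_D x * kernel_mean h' x <= c * c2 * wt x.
  move=> mh' hb' x; have /andP[k0 k1] := kernel_mean_bound x mh' hb'.
  rewrite indicE; case: (_ \in _); rewrite ?mul1r ?mul0r ?k0 ?k1 ?lexx//=.
  exact: le_trans k0 k1.
have mg (D : set Rd) (h' : Rd -> R) : measurable D -> measurable_fun setT h' ->
    (forall x, 0 <= h' x <= c * wt x) -> measurable_fun setT (fun x => \1_D x * kernel_mean h' x).
  move=> mD' mh' hb'; apply: measurable_funM; first exact: measurable_indic.
  by apply: measurable_kernel_mean => // x; have /andP[] := hb' x.
have num : (\int[Pn (s k)]_x (\1_(Qn (s k) @^-1` [set m]) x * kernel_mean (h_ k) x)%:E)%E @[k --> \oo]
    --> (\int[P]_x (\1_(Q @^-1` [set m]) x * kernel_mean h x)%:E)%E.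
  (* The exceptional set here is that of the quantizers; [N'] is absorbed by [cvg_kernel_mean]. *)
  apply: (cP s _ _ (c * c2) N) => //.
  - by move=> k; exact: mg.
  - exact: mg.
  - by move=> k; exact: gb.
  - exact: gb.
  move=> x nN; apply: cvgM; last exact: cvg_kernel_mean kN' hh.
  apply: cvg_near_cst; have := near_subseq hs (hQ _ nN); apply: filterS => k Qk.
  by rewrite !indicE; congr (_%:R); congr nat_of_bool; apply/idP/idP => /set_mem /= e;
    apply/mem_set => /=; rewrite -e Qk.
rewrite (upd_mean QQ P0 mh hb).
have numfin : (\int[P]_x (\1_(Q @^-1` [set m]) x * kernel_mean h x)%:E)%E \is a fin_num.
  apply: (@integral_dominated_fin _ _ (c * c2)) => //; first exact: mg.
  by move=> x; have /andP[g0 g1] := gb (Q @^-1` [set m]) h mh hb x; rewrite ger0_norm.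
have hp : ((fine (p k))^-1)%:E @[k --> \oo] --> ((fine (P (Q @^-1` [set m])))^-1)%:E.
  apply: cvg_EFin; first exact: nearW.
  apply: cvgV; first by rewrite gt_eqF// fine_gt0// P0 ltey_eq Pfin.
  by apply: fine_cvg; rewrite fineK.
have def : (((fine (P (Q @^-1` [set m])))^-1)%:E *?
    \int[P]_x (\1_(Q @^-1` [set m]) x * kernel_mean h x)%:E)%E.
  exact: mule_def_fin.
apply: cvg_trans (cvgeM def hp num).
(* [upd] is specified on cells of positive mass, which these cells eventually have. *)
apply: near_eq_cvg; move: near0; apply: filterS => k pk.
by rewrite (upd_mean (QQn _) pk (mh_ k) (hb_ k)).
Qed.

End BeliefConvergence.

(** * Lower semicontinuity of the distortion *)

Section LowerLimit.
Variable R : realType.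
Implicit Types (u v : nat -> \bar R) (l : \bar R).

(** Says that [l] is at most the lower limit of [u]; testing with real [b] treats infinite [l]
    uniformly. *)
Definition lower_lim u l :=
  forall b : R, (b%:E < l)%E -> \forall n \near \oo, (b%:E < u n)%E.

Lemma lower_lim_add u v l l' : (0 <= l)%E -> (0 <= l')%E ->
  lower_lim u l -> lower_lim v l' -> lower_lim (fun n => u n + v n)%E (l + l')%E.
Proof.
move=> l0 l'0 ul vl b bl.
have [b1 [b2 [b1l b2l bb]]] : exists b1 b2 : R,
    [/\ (b1%:E < l)%E, (b2%:E < l')%E & b <= b1 + b2].
  move: l l' l0 l'0 bl {ul vl} => [r| |] [r'| |] //= r0 r'0 bl.
  - move: bl; rewrite -EFinD lte_fin => bl; set e := (r + r' - b) / 2.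
    have e0 : 0 < e by rewrite divr_gt0// subr_gt0.
    exists (r - e), (r' - e); rewrite !lte_fin !gtrBl; split => //.
    by rewrite /e; lra.
  - exists (r - 1), (b - (r - 1)); rewrite lte_fin ltry; split => //; lra.
  - exists (b - (r' - 1)), (r' - 1); rewrite lte_fin ltry; split => //; lra.
  - by exists b, 0; rewrite !ltry addr0.
apply: filterS2 (ul _ b1l) (vl _ b2l) => n h1 h2.
apply: le_lt_trans (_ : (b1 + b2)%:E < _)%E; first by rewrite lee_fin.
by rewrite EFinD lteD.
Qed.

Lemma lower_lim_sum M (u : 'I_M -> nat -> \bar R) (l : 'I_M -> \bar R) :
  (forall i, 0 <= l i)%E -> (forall i, lower_lim (u i) (l i)) ->
  lower_lim (fun n => \sum_(i < M) u i n)%E (\sum_(i < M) l i)%E.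
Proof.
move=> l0 ul.
rewrite (_ : (fun n => _) = (\sum_(i < M) u i)%R); last first.
  by apply/funext => n; rewrite (big_morph (fun g : nat -> \bar R => g n) (id1 := 0%E) (op1 := adde)).
suff : (0 <= \sum_(i < M) l i)%E /\ lower_lim (\sum_(i < M) u i) (\sum_(i < M) l i)%E by case.
apply: (big_ind2 (fun u l => (0 <= l)%E /\ lower_lim u l)).
- by split => // b b0; exact: nearW.
- move=> u1 l1 u2 l2 [? ?] [? ?]; split; [exact: adde_ge0|exact: lower_lim_add].
- by [].
Qed.

Lemma lower_lim_cvg u l : u @ \oo --> l -> lower_lim u l.
Proof.
by move=> ul b bl; apply: (ul [set x | b%:E < x]%E); exact: open_ereal_gt'.
Qed.

(** When [p' = 0] the limit is 0 even if [l] is infinite, and nonnegativity suffices. Hence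
    semicontinuity of [u] is asked for only at positive mass, where the update is specified. *)
Lemma lower_lim_mul (p : nat -> \bar R) (p' : \bar R) u l :
  p' \is a fin_num -> (0 <= p')%E -> p @ \oo --> p' -> (forall n, 0 <= p n)%E ->
  (forall n, 0 <= u n)%E -> (0 <= l)%E -> ((0 < p')%E -> lower_lim u l) ->
  lower_lim (fun n => p n * u n)%E (p' * l)%E.
Proof.
move=> p'fin p'0 pp p0 u0 l0 ul b bl.
have [b0|b0] := ltP b 0.
  by apply: nearW => n; apply: lt_le_trans (mule_ge0 (p0 n) (u0 n)); rewrite lte_fin.
have {}p'0 : (0 < p')%E.
  rewrite lt_neqAle p'0 andbT; apply: contraTN bl => /eqP <-.
  by rewrite mul0e lte_fin -leNgt.
have [r rl rb] : exists2 r : R, (r%:E < l)%E & (b%:E < p' * r%:E)%E.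
  move: p'fin p'0 bl; case: p' {pp ul} => [p'| |]// _; rewrite lte_fin => p'0.
  case: l l0 => [l| |]// l0 bl.
    rewrite -EFinM lte_fin in bl.
    exists ((b / p' + l) / 2); rewrite ?lte_fin -?EFinM ?lte_fin.
      by rewrite -ltr_pdivrMl// in bl; rewrite mulrC in bl; lra.
    rewrite -ltr_pdivrMl// mulrC; rewrite -ltr_pdivrMl// mulrC in bl; lra.
  exists ((b + 1) / p'); rewrite ?ltry// -EFinM lte_fin mulrC divfK ?gt_eqF//; lra.
have r0 : 0 < r.
  rewrite -lte_fin -(@pmule_rgt0 _ p')//; apply: le_lt_trans rb; by rewrite lee_fin.
have pr : (p n * r%:E)%E @[n --> \oo] --> (p' * r%:E)%E.
  by apply: cvgeM pp (cvg_cst _); rewrite mule_def_fin.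
apply: filterS2 (lower_lim_cvg pr rb) (ul p'0 _ rl) => n h1 h2.
by apply: lt_le_trans h1 _; apply: lee_wpmul2l => //; exact: ltW.
Qed.

End LowerLimit.

Section CellCost.
Variables (R : realType) (d M : nat).
Local Notation Rd := (d.-tuple R).
Local Notation proba := (probability Rd R).
Variable f : Rd -> Rd -> Rd.
Variable nu : proba.

Lemma belief_cvg_wt (Pn : nat -> proba) P : belief_cvg f nu Pn P -> fin2 P ->
  (\int[Pn k]_x (wt x)%:E)%E @[k --> \oo] --> (\int[P]_x (wt x)%:E)%E.
Proof.
move=> cP fP; apply: (cP (fun k => k) (fun=> @wt R d) _ 1 set0) => //.
- by move=> k; exact: measurable_wt.
- exact: measurable_wt.
- by move=> k x; rewrite wt_ge0 mul1r lexx.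
- by move=> x; rewrite wt_ge0 mul1r lexx.
- by split => // x; exact: measure0.
- by move=> x _; exact: cvg_cst.
Qed.

Lemma belief_cvg_fin2 (Pn : nat -> proba) P : belief_cvg f nu Pn P -> fin2 P ->
  \forall k \near \oo, fin2 (Pn k).
Proof.
move=> cP fP; have := belief_cvg_wt cP fP.
have Pfin : (\int[P]_x (wt x)%:E)%E \is a fin_num.
  rewrite ge0_fin_numE; first by rewrite integral_wt lte_add_pinfty// ltry.
  by apply: integral_ge0 => x _; rewrite lee_fin wt_ge0.
rewrite -(fineK Pfin) => /fine_cvgP[+ _]; apply: filterS => k.
rewrite integral_wt fin_numD => /andP[_]; rewrite ge0_fin_numE//.
by apply: integral_ge0 => x _; rewrite lee_fin tsqnorm_ge0.
Qed.

Definition mean (P : proba) (h : Rd -> R) : R := fine (\int[P]_x (h x)%:E)%E.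

Lemma mean_lin (P : proba) (h g : Rd -> R) c c' a b : fin2 P ->
  measurable_fun setT h -> measurable_fun setT g ->
  (forall x, `|h x| <= c * wt x) -> (forall x, `|g x| <= c' * wt x) ->
  mean P (fun x => a * h x + b * g x) = a * mean P h + b * mean P g.
Proof.
move=> fP mh mg hh hg; apply: EFin_inj.
have ih := integral_dominated fP mh hh; have ig := integral_dominated fP mg hg.
have fh := integral_dominated_fin fP mh hh; have fg := integral_dominated_fin fP mg hg.
rewrite EFinD !EFinM /mean !fineK//.
  rewrite -!integralZl// -integralD//; first exact: integrableZl.
  exact: integrableZl.
apply: (@integral_dominated_fin _ _ _ _ (`|a| * c + `|b| * c')) => //.
  by apply: measurable_funD; apply: measurable_funM.
move=> x; rewrite mulrDl (le_trans (ler_normD _ _))// lerD// normrM -mulrA ler_wpM2l//.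
Qed.

(** [belief_cvg] handles nonnegative functions; adding [c * wt] makes a signed one nonnegative with
    bound [2 * c * wt], and the means of [wt] converge. *)
Lemma belief_cvg_mean (Pn : nat -> proba) P (h_ : nat -> Rd -> R) (h : Rd -> R) c (N : set Rd) :
  belief_cvg f nu Pn P -> fin2 P ->
  (forall k, measurable_fun setT (h_ k)) -> measurable_fun setT h ->
  (forall k x, `|h_ k x| <= c * wt x) -> (forall x, `|h x| <= c * wt x) ->
  kernel_null f nu N -> P N = 0%E -> (forall x, ~ N x -> h_ ^~ x @ \oo --> h x) ->
  mean (Pn k) (h_ k) @[k --> \oo] --> mean P h.
Proof.
move=> cP fP mh_ mh hb_ hb kN PN hh.
have mwt := @measurable_wt R d.
have bg (g : Rd -> R) : (forall x, `|g x| <= c * wt x) ->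
    forall x, 0 <= 1 * g x + c * wt x <= (2 * c) * wt x.
  by move=> gb x; have := gb x; rewrite ler_norml => /andP[]; lra.
have mg (g : Rd -> R) : measurable_fun setT g -> measurable_fun setT (fun x => 1 * g x + c * wt x).
  by move=> mg; apply: measurable_funD; apply: measurable_funM.
have wtb (x : Rd) : `|wt x| <= 1 * wt x by rewrite ger0_norm ?wt_ge0 ?mul1r.
have c1 : mean (Pn k) (fun x => 1 * h_ k x + c * wt x) @[k --> \oo] --> mean P (fun x => 1 * h x + c * wt x).
  apply: fine_cvg; rewrite fineK; last first.
    apply: (@integral_dominated_fin _ _ _ _ (2 * c)) => //; first exact: mg.
    by move=> x; have /andP[g0 g1] := bg _ hb x; rewrite ger0_norm.
  apply: (cP (fun k => k) _ _ (2 * c) N) => //.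
  - by move=> k; exact: mg.
  - exact: mg.
  - by move=> k x; exact: bg.
  - by move=> x; exact: bg.
  - by move=> x nN; apply: cvgD; [apply: cvgM; [exact: cvg_cst|exact: hh]|exact: cvg_cst].
have c2 : mean (Pn k) (@wt R d) @[k --> \oo] --> mean P (@wt R d).
  apply: fine_cvg; rewrite fineK; last exact: (integral_dominated_fin fP mwt wtb).
  exact: belief_cvg_wt.
have -> : mean P h = mean P (fun x => 1 * h x + c * wt x) - c * mean P (@wt R d).
  by rewrite (mean_lin _ _ fP mh mwt hb wtb) mul1r addrK.
apply: cvg_trans (cvgB c1 (cvgM (cvg_cst c) c2)).
apply: near_eq_cvg; have := belief_cvg_fin2 cP fP; apply: filterS => k fk.
by rewrite /= !fctE (mean_lin _ _ fk (mh_ k) mwt (hb_ k) wtb) mul1r addrK.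
Qed.

End CellCost.

Lemma cvgr_sum (R : realType) (I : Type) (s : seq I) (g : I -> nat -> R) (l : I -> R) :
  (forall i, g i n @[n --> \oo] --> l i) ->
  (\sum_(i <- s) g i n) @[n --> \oo] --> \sum_(i <- s) l i.
Proof.
move=> gl; elim: s => [|i s IH].
  by under eq_fun do rewrite big_nil; rewrite big_nil; exact: cvg_cst.
by under eq_fun do rewrite big_cons; rewrite big_cons; exact: cvgD.
Qed.

(** * Cell costs as functions of moments *)

Section Distortion.
Variables (R : realType) (d : nat).
Local Notation Rd := (d.-tuple R).
Local Notation proba := (probability Rd R).

Definition cell_cost (P : proba) (D : set Rd) : \bar R :=
  ereal_inf [set (\int[P]_(x in D) (tsqnorm (tsub x u))%:E)%E | u in [set: Rd]].

Lemma cell_cost_ge0 P D : (0 <= cell_cost P D)%E.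
Proof.
apply: le_ereal_inf_tmp => _ [u _ <-].
by apply: integral_ge0 => x _; rewrite lee_fin tsqnorm_ge0.
Qed.

Definition moment0 (P : proba) (D : set Rd) : R := mean P \1_D.
Definition moment1 (P : proba) (D : set Rd) (j : 'I_d) : R :=
  mean P (fun x => \1_D x * tnth x j).
Definition moment2 (P : proba) (D : set Rd) (j : 'I_d) : R :=
  mean P (fun x => \1_D x * tnth x j ^+ 2).

Lemma sqr_le_tsqnorm (x : Rd) j : tnth x j ^+ 2 <= tsqnorm x.
Proof. by rewrite /tsqnorm (bigD1 j)//= lerDl sumr_ge0// => i _; rewrite sqr_ge0. Qed.

Lemma indic_le1 (D : set Rd) x (r c : R) : 0 <= c -> `|r| <= c -> `|\1_D x * r| <= c.
Proof.
by move=> c0 rc; rewrite indicE; case: (_ \in _); rewrite ?mul1r ?mul0r ?normr0.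
Qed.

Lemma moment_bounds (D : set Rd) (x : Rd) j :
  [/\ `|\1_D x : R| <= 1 * wt x, `|\1_D x * tnth x j| <= 1 * wt x
    & `|\1_D x * tnth x j ^+ 2| <= 1 * wt x].
Proof.
have w0 : 0 <= 1 * wt x by rewrite mul1r wt_ge0.
have h := sqr_le_tsqnorm x j.
split.
- by rewrite -[\1_D x]mulr1; apply: indic_le1 => //; rewrite normr1 mul1r wt_ge1.
- apply: indic_le1 => //; rewrite mul1r /wt ler_norml; apply/andP; split; nra.
- apply: indic_le1 => //; rewrite mul1r /wt ger0_norm ?sqr_ge0//; lra.
Qed.

Lemma measurable_moments (D : set Rd) j : measurable D ->
  [/\ measurable_fun setT (\1_D : Rd -> R),
      measurable_fun setT (fun x : Rd => \1_D x * tnth x j : R)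
    & measurable_fun setT (fun x : Rd => \1_D x * tnth x j ^+ 2 : R)].
Proof.
move=> mD; have mi : measurable_fun setT (\1_D : Rd -> R) by exact: measurable_indic.
have mt : measurable_fun setT (fun x : Rd => tnth x j) by exact: measurable_tnth.
by split=> //; apply: measurable_funM => //; apply: measurable_funX.
Qed.

Lemma distortion_moments P D (u : Rd) : fin2 P -> measurable D ->
  (\int[P]_(x in D) (tsqnorm (tsub x u))%:E)%E =
  (\sum_j (moment2 P D j - 2 * tnth u j * moment1 P D j + tnth u j ^+ 2 * moment0 P D))%:E.
Proof.
move=> fP mD; rewrite /tsqnorm.
under eq_integral do rewrite -sumEFin.
rewrite ge0_integral_sum//; last 2 first.
- move=> j; apply: measurable_funTS; apply/measurable_EFinP; apply: measurable_funX.
  rewrite (_ : (fun x => _) = (fun x => tnth x j - tnth u j)); last first.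
    by apply/funext => x; rewrite tnth_mktuple.
  by apply: measurable_funB => //; exact: measurable_tnth.
- by move=> j x _; rewrite lee_fin sqr_ge0.
rewrite -sumEFin; apply: eq_bigr => j _.
have [m0 m1 m2] := measurable_moments j mD.
have b0 x := let: And3 h _ _ := moment_bounds D x j in h.
have b1 x := let: And3 _ h _ := moment_bounds D x j in h.
have b2 x := let: And3 _ _ h := moment_bounds D x j in h.
set a := tnth u j.
have m21 : measurable_fun setT (fun x : Rd => 1 * (\1_D x * tnth x j ^+ 2) + (- (2 * a)) * (\1_D x * tnth x j) : R).
  by apply: measurable_funD; apply: measurable_funM.
have b21 x : `|1 * (\1_D x * tnth x j ^+ 2) + (- (2 * a)) * (\1_D x * tnth x j)| <= (1 + `|2 * a|) * wt x.
  apply: le_trans (ler_normD _ _) _; rewrite [leRHS]mulrDl; apply: lerD.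
    by rewrite [1 * (_ * _)]mul1r; exact: b2.
  by rewrite normrM normrN ler_wpM2l//; have := b1 x; rewrite [1 * wt x]mul1r.
pose g (x : Rd) := 1 * (1 * (\1_D x * tnth x j ^+ 2) + (- (2 * a)) * (\1_D x * tnth x j)) + a ^+ 2 * \1_D x.
have -> : moment2 P D j - 2 * a * moment1 P D j + a ^+ 2 * moment0 P D = mean P g.
  by rewrite /g (mean_lin _ _ fP m21 m0 b21 b0) (mean_lin _ _ fP m2 m1 b2 b1) !mul1r mulNr.
rewrite /mean fineK; last first.
  apply: (@integral_dominated_fin _ _ _ _ (`|1| * (1 + `|2 * a|) + `|a ^+ 2| * 1)) => //.
    by apply: measurable_funD; apply: measurable_funM.
  move=> x; rewrite /g [leRHS]mulrDl; apply: le_trans (ler_normD _ _) _.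
  by apply: lerD; rewrite normrM -mulrA ler_wpM2l.
rewrite integral_mkcond; apply: eq_integral => x _.
rewrite patchE /g tnth_mktuple indicE; case: ifPn => _ /=; last by rewrite !(mul0r, mulr0, addr0).
by congr EFin; rewrite -/a; ring.
Qed.

(* Complete the square in each coordinate of [u]. *)
Lemma cell_cost_lower P D : fin2 P -> measurable D -> 0 < moment0 P D ->
  ((\sum_j (moment2 P D j - moment1 P D j ^+ 2 / moment0 P D))%:E <= cell_cost P D)%E.
Proof.
move=> fP mD m0; apply: le_ereal_inf_tmp => _ [u _ <-].
rewrite distortion_moments// lee_fin; apply: ler_sum => j _.
rewrite -subr_ge0; set z := moment0 P D in m0 *; set w := moment1 P D j.
rewrite (_ : _ - _ = (tnth u j * z - w) ^+ 2 / z); first by rewrite divr_ge0 ?sqr_ge0 ?ltW.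
by field; rewrite gt_eqF.
Qed.

Lemma cell_cost_upper P D : fin2 P -> measurable D -> 0 < moment0 P D ->
  (cell_cost P D <= (\sum_j (moment2 P D j - moment1 P D j ^+ 2 / moment0 P D))%:E)%E.
Proof.
(* The optimal reproduction point is the centroid of the cell. *)
move=> fP mD m0; pose u : Rd := [tuple moment1 P D j / moment0 P D | j < d].
apply: ge_ereal_inf; exists (\int[P]_(x in D) (tsqnorm (tsub x u))%:E)%E; first by exists u.
rewrite distortion_moments// lee_fin; apply: ler_sum => j _.
by rewrite /u tnth_mktuple le_eqVlt; apply/orP; left; apply/eqP; field; rewrite gt_eqF.
Qed.

Lemma moment0E P D : measurable D -> (moment0 P D)%:E = P D.
Proof.
by move=> mD; rewrite /moment0 /mean integral_indic// setIT fineK// fin_num_measure.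
Qed.

Variables (f : Rd -> Rd -> Rd) (nu : proba).

(** If the limit cell has positive mass, its cost is a continuous function of moments that converge;
    if it is null, its cost is 0 and nonnegativity suffices. *)
Lemma lower_lim_cell_cost (Pn : nat -> proba) P (Dn : nat -> set Rd) D N :
  belief_cvg f nu Pn P -> fin2 P -> (forall n, measurable (Dn n)) -> measurable D ->
  kernel_null f nu N -> P N = 0%E ->
  (forall x, ~ N x -> \forall n \near \oo, Dn n x <-> D x) ->
  lower_lim (fun n => cell_cost (Pn n) (Dn n)) (cell_cost P D).
Proof.
move=> cP fP mDn mD kN PN hD b bc.
have [b0|b0] := ltP b 0.
  by apply: nearW => n; apply: lt_le_trans (cell_cost_ge0 _ _); rewrite lte_fin.
have m00 : 0 < moment0 P D.
  rewrite lt_neqAle eq_sym -lee_fin moment0E// measure_ge0 andbT.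
  apply: contraTN bc => /eqP m00; rewrite -leNgt.
  apply: ge_ereal_inf.
  exists (\int[P]_(x in D) (tsqnorm (tsub x [tuple 0 | _ < d]))%:E)%E; first by exists [tuple 0 | _ < d].
  rewrite distortion_moments// lee_fin.
  have PD : P D = 0%E by rewrite -moment0E// m00.
  have mean0 (h : Rd -> R) : measurable_fun setT (fun x => \1_D x * h x) -> mean P (fun x => \1_D x * h x) = 0.
    move=> mh; rewrite /mean (_ : (\int[P]_x _)%E = 0%E)//.
    rewrite -(@null_set_integral _ _ _ P D (fun x => (\1_D x * h x)%:E))//.
    - rewrite [RHS]integral_mkcond; apply: eq_integral => x _; rewrite patchE /= indicE.
      by case: (boolP (x \in D)) => _ //; rewrite mul0r.
    - by apply: measurable_funTS; exact/measurable_EFinP.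
  rewrite big1// => j _; have [_ m1 m2] := measurable_moments j mD.
  rewrite /moment2 /moment1 (mean0 (fun x => tnth x j ^+ 2))// (mean0 (fun x => tnth x j))//.
  by rewrite m00 !mulr0 subr0 addr0.
have b1 (D' : set Rd) j x := let: And3 _ h _ := moment_bounds D' x j in h.
have b2 (D' : set Rd) j x := let: And3 _ _ h := moment_bounds D' x j in h.
have m1 (D' : set Rd) j mD' := let: And3 _ h _ := @measurable_moments D' j mD' in h.
have m2 (D' : set Rd) j mD' := let: And3 _ _ h := @measurable_moments D' j mD' in h.
have ci x : ~ N x -> (\1_(Dn n) x : R) @[n --> \oo] --> (\1_D x : R).
  move=> nN; apply: cvg_near_cst; have := hD _ nN; apply: filterS => n DnD.
  rewrite !indicE; congr (_%:R); congr nat_of_bool.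
  by apply/idP/idP => /set_mem h; apply/mem_set; apply/DnD.
have cm2 j : moment2 (Pn n) (Dn n) j @[n --> \oo] --> moment2 P D j.
  apply: (@belief_cvg_mean _ _ f nu _ _ _ _ 1 N cP fP) => //; try by move=> *; exact: b2.
  - by move=> k; exact: m2.
  - exact: m2.
  - by move=> x nN; apply: cvgM; [exact: ci|exact: cvg_cst].
have cm1 j : moment1 (Pn n) (Dn n) j @[n --> \oo] --> moment1 P D j.
  apply: (@belief_cvg_mean _ _ f nu _ _ _ _ 1 N cP fP) => //; try by move=> *; exact: b1.
  - by move=> k; exact: m1.
  - exact: m1.
  - by move=> x nN; apply: cvgM; [exact: ci|exact: cvg_cst].
have cm0 : moment0 (Pn n) (Dn n) @[n --> \oo] --> moment0 P D.
  have ib (D' : set Rd) (x : Rd) : `|\1_D' x : R| <= 1 * wt x.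
    rewrite -[\1_D' x]mulr1; apply: indic_le1; first by rewrite mul1r wt_ge0.
    by rewrite normr1 mul1r wt_ge1.
  apply: (@belief_cvg_mean _ _ f nu _ _ _ _ 1 N cP fP) => //; exact: ci.
pose r n := \sum_j (moment2 (Pn n) (Dn n) j - moment1 (Pn n) (Dn n) j ^+ 2 / moment0 (Pn n) (Dn n)).
pose r' := \sum_j (moment2 P D j - moment1 P D j ^+ 2 / moment0 P D).
have cr : r n @[n --> \oo] --> r'.
  rewrite /r /r'; apply: cvgr_sum => j; apply: cvgB => //.
  apply: cvgM; last by apply: cvgV => //; rewrite gt_eqF.
  by apply: (cvgM (cm1 j) (cm1 j)).
have br' : b < r' by rewrite -lte_fin; apply: lt_le_trans bc _; exact: cell_cost_upper.
have n1 : \forall n \near \oo, b < r n by exact: cvgr_gt cr _ br'.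
have n2 : \forall n \near \oo, 0 < moment0 (Pn n) (Dn n) by exact: cvgr_gt cm0 _ m00.
have n3 := belief_cvg_fin2 cP fP.
apply: filterS3 n1 n2 n3 => n h1 h2 h3.
by apply: lt_le_trans (cell_cost_lower _ _ _) => //; rewrite lte_fin.
Qed.

End Distortion.

(** * Existence of optimal quantizers *)

Section DynamicProgramming.
Variables (R : realType) (d M T : nat).
Local Notation Rd := (d.-tuple R).
Local Notation proba := (probability Rd R).
Hypothesis hM : (0 < M)%N.
Variable f : Rd -> Rd -> Rd.
Hypothesis hf : measurable_fun [set: Rd * Rd] (fun p : Rd * Rd => f p.1 p.2).
Variable nu : proba.
Variable upd : belief_update R d M.
Hypothesis updE : kernel_update f nu upd.
Variable c2 : R.
Hypothesis kernel_wt : forall x, (\int[nu]_w (wt (f x w))%:E <= (c2 * wt x)%:E)%E.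
Hypothesis kernel_hyper : forall a b, nontriv a b ->
  forall x, nu [set w | hyper a b (f x w)] = 0%E.

(* The exceptional point [x0] is there for a point mass at [x0]. *)
Definition regular_belief (P : proba) := fin2 P /\
  exists x0, forall a b, nontriv a b -> P (hyper a b `\ x0) = 0%E.

Lemma measurable_hyperD1 (a : Rd) b x0 : measurable (hyper a b `\ x0).
Proof.
apply: measurableD; first exact: measurable_hyper.
rewrite (_ : [set x0] = \bigcap_(i in [set: 'I_d])
    (setT `&` (fun x : Rd => tnth x i) @^-1` [set tnth x0 i])).
  apply: fin_bigcap_measurable => [|i _]; first exact: finite_finset.
  exact: (measurable_tnth i).
apply/seteqP; split => [x -> i _ //|x /= H]; apply/eq_from_tnth => i.
by have [] := H i I.
Qed.

Lemma kernel_null_hyperD1 a b x0 : nontriv a b -> kernel_null f nu (hyper a b `\ x0).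
Proof.
move=> nab; split=> [|x]; first exact: measurable_hyperD1.
apply/eqP; rewrite -measure_le0 -(kernel_hyper nab x); apply: le_measure.
- rewrite inE -[X in measurable X]setTI; apply: (measurable_fx hf x) => //.
  exact: measurable_hyperD1.
- rewrite inE -[X in measurable X]setTI; apply: (measurable_fx hf x) => //.
  exact: measurable_hyper.
- by move=> w [].
Qed.

Lemma kernel_nullU A B : kernel_null f nu A -> kernel_null f nu B -> kernel_null f nu (A `|` B).
Proof.
move=> [mA A0] [mB B0]; split=> [|x]; first exact: measurableU.
by apply: (null_set_setU _ _ (A0 x) (B0 x));
  rewrite -[X in measurable X]setTI; exact: (measurable_fx hf x).
Qed.

(** After one transition no hyperplane is charged, so any point can serve as the exceptional one. *)
Lemma regular_upd m (P : proba) (Q : quantizer R d M) :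
  fin2 P -> Qc Q -> (0 < P (Q @^-1` [set m]))%E -> regular_belief (upd m P Q).
Proof.
move=> fP QQ P0; split; first exact: (fin2_upd hf updE kernel_wt fP QQ P0).
exists [tuple 0 | _ < d] => a b nab.
by apply: (upd_null hf updE QQ P0); exact: kernel_null_hyperD1.
Qed.

(** Convergence can fail only on the separating hyperplanes of the limit; [x0] is removed from them
    because the subsequence was chosen to converge there too. *)
Lemma quantizer_compact (P : proba) (Qn : nat -> quantizer R d M) :
  regular_belief P -> (forall n, Qc (Qn n)) ->
  exists (Q : quantizer R d M) (r : nat -> nat) (N : set Rd),
  [/\ Qc Q, (forall k, (k <= r k)%N), kernel_null f nu N, P N = 0%E &
    forall x, ~ N x -> \forall k \near \oo, Qn (r k) x = Q x].
Proof.
move=> [_ [x0 Px0]] QQn.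
have [|Q [r [a [b [cQ hr nab hQ]]]]] := @convex_partition_compact R d M Qn x0.
  by move=> n i; have [] := QQn n i.
pose N := \big[setU/set0]_(p : 'I_M * 'I_M | p.1 != p.2) (hyper (a p.1 p.2) (b p.1 p.2) `\ x0).
exists Q, r, N; split => //.
- by move=> i; split; [exact: convex_partition_measurable|exact: cQ].
- apply: (big_ind (kernel_null f nu)) => [|A B|p pne].
  + by split=> // x; exact: measure0.
  + exact: kernel_nullU.
  + by apply: kernel_null_hyperD1; exact: nab.
- suff [] : measurable N /\ P N = 0%E by [].
  apply: (big_ind (fun N => measurable N /\ P N = 0%E)) => [|A B [mA A0] [mB B0]|p pne].
  + by split => //; exact: measure0.
  + by split; [exact: measurableU|exact: null_set_setU].
  + by split; [exact: measurable_hyperD1|apply: Px0; exact: nab].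
move=> x nN; apply: hQ; have [->|xx0] := pselect (x = x0); [by left|right] => i j ij hx.
by apply: nN; rewrite /N (bigD1 (i, j))//=; left.
Qed.

Lemma Jrem_ge0 k P : (0 <= Jrem T upd k P)%E.
Proof.
elim: k P => [|k IH] P //=; apply: le_ereal_inf_tmp => _ [Q QQ <-].
rewrite /dp_bracket adde_ge0//.
  rewrite mule_ge0 ?lee_fin// /qcost; apply: sume_ge0 => i _; exact: cell_cost_ge0.
by apply: sume_ge0 => m _; rewrite mule_ge0.
Qed.

Lemma qcost_ge0 (P : proba) (Q : quantizer R d M) : (0 <= qcost P Q)%E.
Proof. by apply: sume_ge0 => i _; exact: cell_cost_ge0. Qed.

Definition lsc_value k := forall (Pn : nat -> proba) P,
  belief_cvg f nu Pn P -> regular_belief P ->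
  lower_lim (fun n => Jrem T upd k (Pn n)) (Jrem T upd k P).

Lemma lower_lim_dp k (Pn : nat -> proba) P (Qn : nat -> quantizer R d M) Q N :
  lsc_value k -> belief_cvg f nu Pn P -> regular_belief P ->
  (forall n, Qc (Qn n)) -> Qc Q -> kernel_null f nu N -> P N = 0%E ->
  (forall x, ~ N x -> \forall n \near \oo, Qn n x = Q x) ->
  lower_lim (fun n => dp_bracket T upd (Jrem T upd k) (Pn n) (Qn n))
    (dp_bracket T upd (Jrem T upd k) P Q).
Proof.
move=> lk cP [fP Px0] QQn QQ kN PN hQ.
have mD i : measurable (Q @^-1` [set i]) by have [] := QQ i.
have mDn n i : measurable (Qn n @^-1` [set i]) by have [] := QQn n i.
apply: lower_lim_add.
- by rewrite mule_ge0 ?lee_fin// qcost_ge0.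
- by apply: sume_ge0 => m _; rewrite mule_ge0// Jrem_ge0.
- apply: lower_lim_mul => //; first exact: cvg_cst.
  + by move=> n; exact: qcost_ge0.
  + exact: qcost_ge0.
  move=> _; apply: lower_lim_sum => i; first exact: cell_cost_ge0.
  apply: (lower_lim_cell_cost cP fP _ _ kN PN) => // x nN.
  by have := hQ _ nN; apply: filterS => n /= ->.
apply: lower_lim_sum => m; first by rewrite mule_ge0// Jrem_ge0.
apply: lower_lim_mul => //.
- exact: fin_num_measure.
- exact: (belief_cvg_cell cP QQn QQ kN PN hQ).
- by move=> n; exact: Jrem_ge0.
- exact: Jrem_ge0.
move=> P0; apply: lk; last exact: regular_upd.
exact: (belief_cvg_upd hf updE kernel_wt cP fP QQn QQ kN PN hQ P0).
Qed.

(** Used with varying beliefs for semicontinuity, and with a constant sequence for attainment of the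
    minimum. *)
Lemma dp_near_optimal k (Pn : nat -> proba) P (Qn : nat -> quantizer R d M) (b : R) :
  lsc_value k -> belief_cvg f nu Pn P -> regular_belief P -> (forall n, Qc (Qn n)) ->
  (forall n, dp_bracket T upd (Jrem T upd k) (Pn n) (Qn n) <= (b + n.+1%:R^-1)%:E)%E ->
  exists2 Q, Qc Q & (dp_bracket T upd (Jrem T upd k) P Q <= b%:E)%E.
Proof.
move=> lk cP rP QQn hb.
have [Q [r [N [QQ hr kN PN hQ]]]] := quantizer_compact rP QQn.
exists Q => //; rewrite leNgt; apply/negP => bF.
(* A level strictly between [b] and the bracket leaves room for the errors [n.+1%:R^-1]. *)
have [b' bb' b'F] : exists2 b' : R, b < b' & (b'%:E < dp_bracket T upd (Jrem T upd k) P Q)%E.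
  move: bF; case: (dp_bracket _ _ _ _ _) => [F| |]//; rewrite ?lte_fin => bF.
    by exists ((b + F) / 2); rewrite ?lte_fin; lra.
  by exists (b + 1); rewrite ?ltry//; lra.
have lF := lower_lim_dp lk (belief_cvg_sub hr cP) rP (fun n => QQn (r n)) QQ kN PN hQ.
have b'0 : 0 < b' - b by rewrite subr_gt0.
have n1 : \forall n \near \oo, n.+1%:R^-1 < b' - b :> R.
  near=> n; rewrite invf_plt ?posrE//.
  have : (b' - b)^-1 <= n%:R by near: n; exact: nbhs_infty_ger.
  by move=> h; apply: le_lt_trans h _; rewrite ltr_nat.
have [n [h1 h2]] := filter_ex (filterI (lF _ b'F) n1).
have := lt_le_trans h1 (hb (r n)); rewrite lte_fin.
have : (r n).+1%:R^-1 <= n.+1%:R^-1 :> R by rewrite lef_pV2 ?posrE// ler_nat ltnS.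
move: h2 => /= h2 h3 h4; have := le_lt_trans h3 h2.
by rewrite ltrBrDl ltNge (ltW h4).
Unshelve. all: by end_near. Qed.

(** If values stayed at most [b] along a subsequence, near-minimizers along it would have a limit
    whose bracket at [P] is at most [b]. *)
Lemma lsc_valueP k : lsc_value k.
Proof.
elim: k => [|k IH] Pn P cP rP b bJ; first exact: nearW.
apply: contrapT => nb.
have /choice[s hs] n : exists m, (n <= m)%N /\ (Jrem T upd k.+1 (Pn m) <= b%:E)%E.
  apply: contrapT => /forallNP H; apply: nb; exists n => // m /= nm.
  by rewrite ltNge; apply/negP => Jb; apply: (H m).
have /choice[Qn hQn] n : exists Q, Qc Q /\
    (dp_bracket T upd (Jrem T upd k) (Pn (s n)) Q <= (b + n.+1%:R^-1)%:E)%E.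
  have [_ Jb] := hs n.
  have : (Jrem T upd k.+1 (Pn (s n)) < (b + n.+1%:R^-1)%:E)%E.
    by apply: le_lt_trans Jb _; rewrite lte_fin ltrDl invr_gt0.
  by move=> /ereal_inf_lt[_ [Q QQ <-] /ltW]; exists Q.
have hs' n : (n <= s n)%N by have [] := hs n.
have QQn n : Qc (Qn n) by have [] := hQn n.
have [|Q QQ] := dp_near_optimal IH (belief_cvg_sub hs' cP) rP QQn (b := b).
  by move=> n; have [] := hQn n.
rewrite leNgt => /negP; apply; apply: lt_le_trans bJ _.
by apply: ereal_inf_lbound; exists Q.
Qed.

Lemma Qc_cst : exists Q : quantizer R d M, Qc Q.
Proof.
exists (fun=> Ordinal hM) => i.
have cQ j : Defs.convex_set ((fun _ : Rd => Ordinal hM) @^-1` [set j]) by [].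
by split; [exact: convex_partition_measurable|exact: cQ].
Qed.

Lemma dp_argmin k P : regular_belief P ->
  exists Q, Qc Q /\ Jrem T upd k.+1 P = dp_bracket T upd (Jrem T upd k) P Q.
Proof.
move=> rP.
suff [Q QQ le] : exists2 Q, Qc Q & (dp_bracket T upd (Jrem T upd k) P Q <= Jrem T upd k.+1 P)%E.
  exists Q; split => //; apply/eqP; rewrite eq_le le andbT.
  by apply: ereal_inf_lbound; exists Q.
have := Jrem_ge0 k.+1 P; case E : (Jrem T upd k.+1 P) => [b| |]// _; last first.
  (* At infinite value every quantizer is a minimizer. *)
  by have [Q QQ] := Qc_cst; exists Q => //; rewrite leey.
have /choice[Qn hQn] n : exists Q, Qc Q /\
    (dp_bracket T upd (Jrem T upd k) P Q <= (b + n.+1%:R^-1)%:E)%E.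
  have : (Jrem T upd k.+1 P < (b + n.+1%:R^-1)%:E)%E.
    by rewrite E lte_fin ltrDl invr_gt0.
  by move=> /ereal_inf_lt[_ [Q QQ <-] /ltW]; exists Q.
have [fP _] := rP.
have QQn n : Qc (Qn n) by have [] := hQn n.
have [|Q QQ le] := dp_near_optimal (@lsc_valueP k) (belief_cvg_cst fP) rP QQn (b := b).
  by move=> n; have [] := hQn n.
by exists Q.
Qed.

End DynamicProgramming.

(** * Optimal policies *)

Section BeliefEquivalence.
Variables (R : realType) (d M T : nat).
Local Notation Rd := (d.-tuple R).
Local Notation proba := (probability Rd R).

(* Weaker than equality of the records, whose values on nonmeasurable sets are arbitrary. *)
Definition same_law (P P' : proba) := forall A, measurable A -> P A = P' A.

Lemma same_law_integral (P P' : proba) D (h : Rd -> \bar R) : same_law P P' ->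
  (\int[P]_(x in D) h x = \int[P']_(x in D) h x)%E.
Proof. by move=> PP'; apply: eq_measure_integral => A mA _; exact: PP'. Qed.

Lemma same_law_regular (P P' : proba) : same_law P P' -> regular_belief P -> regular_belief P'.
Proof.
move=> PP' [fP [x0 Px0]]; split; first by rewrite /fin2 -(same_law_integral _ _ PP').
by exists x0 => a b nab; rewrite -PP' ?Px0//; exact: measurable_hyperD1.
Qed.

Variables (f : Rd -> Rd -> Rd) (nu : proba) (upd : belief_update R d M).
Hypothesis updE : kernel_update f nu upd.

Lemma same_law_upd m (P P' : proba) (Q : quantizer R d M) :
  same_law P P' -> Qc Q -> (0 < P (Q @^-1` [set m]))%E -> same_law (upd m P Q) (upd m P' Q).
Proof.
move=> PP' QQ P0 A mA; have [mD _] := QQ m.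
have P'0 : (0 < P' (Q @^-1` [set m]))%E by rewrite -PP'.
have mi : measurable_fun setT (fun x => (\1_A x : R)%:E).
  by apply/measurable_EFinP; exact: measurable_indic.
rewrite -[A]setIT -!(integral_indic _ measurableT mA).
rewrite (updE QQ P0 mi) => [|z]; last by rewrite lee_fin.
rewrite (updE QQ P'0 mi) => [|z]; last by rewrite lee_fin.
by rewrite PP'// (same_law_integral _ _ PP').
Qed.

Lemma same_law_bracket J (P P' : proba) (Q : quantizer R d M) :
  (forall P P', same_law P P' -> J P = J P') -> same_law P P' -> Qc Q ->
  dp_bracket T upd J P Q = dp_bracket T upd J P' Q.
Proof.
move=> hJ PP' QQ; rewrite /dp_bracket; congr (_ * _ + _)%E.
  apply: eq_bigr => i _; congr ereal_inf.
  by apply: eq_imagel => u _; exact: same_law_integral.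
apply: eq_bigr => m _; have [mD _] := QQ m; rewrite -PP'//.
have := measure_ge0 P (Q @^-1` [set m]); rewrite le_eqVlt => /orP[/eqP <-|P0].
  by rewrite !mul0e.
by congr (_ * _)%E; apply: hJ; exact: same_law_upd.
Qed.

Lemma same_law_Jrem k (P P' : proba) : same_law P P' -> Jrem T upd k P = Jrem T upd k P'.
Proof.
elim: k P P' => [|k IH] P P' PP' //=; congr ereal_inf.
by apply: eq_imagel => Q QQ; exact: same_law_bracket.
Qed.

End BeliefEquivalence.

(** * Borel policies prescribed at finitely many beliefs *)

Section FinitePolicy.
Variables (R : realType) (d M : nat).
Local Notation Rd := (d.-tuple R).
Local Notation proba := (probability Rd R).

Lemma PmeasurableC (E : set proba) : Pmeasurable E -> Pmeasurable (~` E).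
Proof.
have [_ hC _] := smallest_sigma_algebra setT (@Pgen R d).
by move=> /hC; rewrite setTD.
Qed.

Lemma PmeasurableU (E F : set proba) : Pmeasurable E -> Pmeasurable F -> Pmeasurable (E `|` F).
Proof.
have [h0 _ hU] := smallest_sigma_algebra setT (@Pgen R d).
move=> mE mF; rewrite -bigcup2E; apply: hU => -[|[|i]] //=.
Qed.

Lemma PmeasurableI (E F : set proba) : Pmeasurable E -> Pmeasurable F -> Pmeasurable (E `&` F).
Proof.
move=> mE mF; rewrite -[E `&` F]setCK setCI.
by apply: PmeasurableC; apply: PmeasurableU; exact: PmeasurableC.
Qed.

Lemma Pmeasurable0 : Pmeasurable (set0 : set proba).
Proof. by have [] := smallest_sigma_algebra setT (@Pgen R d). Qed.

Lemma PmeasurableT : Pmeasurable (setT : set proba).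
Proof. by rewrite -setC0; apply: PmeasurableC; exact: Pmeasurable0. Qed.

Lemma Pmeasurable_eval (A : set Rd) (r : \bar R) : measurable A ->
  Pmeasurable [set P : proba | P A = r].
Proof.
move=> mA; apply: sub_sigma_algebra; exists A; split => //.
exists [set r]; split => //; exact: emeasurable_set1.
Qed.

(** For each pair, choose an event where the two laws differ if they do; agreement on it then forces
    equality of laws. *)
Lemma separating_events : exists sep : proba -> proba -> set Rd, forall P P',
  measurable (sep P P') /\ (P (sep P P') = P' (sep P P') -> same_law P P').
Proof.
have H (p : proba * proba) : exists A, measurable A /\ (p.1 A = p.2 A -> same_law p.1 p.2).
  have [h|/existsNP[A /not_implyP[mA nA]]] := pselect (same_law p.1 p.2).
    by exists set0; split.
  by exists A; split.
by have /choice[sep hsep] := H; exists (fun P P' => sep (P, P')) => P P'; exact: hsep (P, P').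
Qed.

Variable sep : proba -> proba -> set Rd.
Hypothesis sepP : forall P P',
  measurable (sep P P') /\ (P (sep P P') = P' (sep P P') -> same_law P P').

(* Finitely many laws are separated by finitely many events, so that a belief-dependent
   choice on a finite list of beliefs extends to a Borel policy. *)
Definition matches (L : seq proba) (P' : proba) : set proba :=
  [set P | forall P'', List.In P'' L -> P (sep P' P'') = P' (sep P' P'')].

Lemma Pmeasurable_matches L P' : Pmeasurable (matches L P').
Proof.
elim: L => [|P1 L IH].
  rewrite (_ : matches _ _ = setT); first exact: PmeasurableT.
  by apply/seteqP; split => P // _ P'' [].
rewrite (_ : matches _ _ = [set P : proba | P (sep P' P1) = P' (sep P' P1)] `&` matches L P').
  by apply: PmeasurableI => //; apply: Pmeasurable_eval; have [] := sepP P' P1.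
apply/seteqP; split => [P H|P [H1 H2] P'' [<-//|]]; last exact: H2.
by split => [|P'' PL]; apply: H; [left|right].
Qed.

(** The recursion runs over [l] while the tests always involve the whole list [L]; [lookupP] relies
    on this. *)
Fixpoint lookup (L l : seq proba) (sel : proba -> quantizer R d M) (Q0 : quantizer R d M)
    (P : proba) : quantizer R d M :=
  if l is P' :: l' then
    if `[< matches L P' P >] then sel P' else lookup L l' sel Q0 P
  else Q0.

(** The map takes finitely many values, each on a Borel set of beliefs, so every preimage is
    Borel. *)
Lemma Pmeasurable_lookup L l sel Q0 (E : set (quantizer R d M)) :
  Pmeasurable (lookup L l sel Q0 @^-1` E).
Proof.
have cst Q : Pmeasurable [set P : proba | E Q].
  have [EQ|nEQ] := pselect (E Q).
    by rewrite (_ : mkset _ = setT); [exact: PmeasurableT|apply/seteqP; split].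
  by rewrite (_ : mkset _ = set0); [exact: Pmeasurable0|apply/seteqP; split].
elim: l => [|P' l IH]; first exact: cst.
rewrite (_ : _ @^-1` E = (matches L P' `&` [set P | E (sel P')]) `|`
  (~` matches L P' `&` lookup L l sel Q0 @^-1` E)).
  have mm := Pmeasurable_matches L P'.
  by apply: PmeasurableU; apply: PmeasurableI => //; exact: PmeasurableC.
apply/seteqP; split => P /=; case: asboolP => mP; [by left|by right|by case=> -[]|].
by case=> -[].
Qed.

Lemma lookup_Qc L l sel Q0 P : (forall P', Qc (sel P')) -> Qc Q0 -> Qc (lookup L l sel Q0 P).
Proof. by move=> cs c0; elim: l => [|P' l IH] //=; case: asboolP. Qed.

(** The first match may be another belief [P'] of the list, but as [P] is itself in [L], the test
    compares the two on [sep P' P]. *)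
Lemma lookupP L sel Q0 P : List.In P L ->
  exists P', same_law P' P /\ lookup L L sel Q0 P = sel P'.
Proof.
move=> PL; suff H l : List.In P l -> exists P', same_law P' P /\ lookup L l sel Q0 P = sel P'.
  exact: H.
elim: l => [|P' l IH] //= Pl; case: asboolP => [mP|nP].
  by exists P'; split => //; have [_] := sepP P' P; apply; rewrite mP.
by case: Pl => [PP'|/IH//]; case: nP; rewrite PP'.
Qed.

End FinitePolicy.

Section Policies.
Variables (R : realType) (d M T : nat).
Local Notation Rd := (d.-tuple R).
Local Notation proba := (probability Rd R).
Variable upd : belief_update R d M.

Lemma policy_value_ge eta k t P : @is_policy R d M eta ->
  (Jrem T upd k P <= policy_value T upd eta k t P)%E.
Proof.
move=> heta; elim: k t P => [|k IH] t P //=.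
have [QQ _] := heta t.
apply: le_trans (_ : dp_bracket T upd (Jrem T upd k) P (eta t P) <= _)%E.
  by apply: ereal_inf_lbound; exists (eta t P).
by apply: leeD => //; apply: lee_sum => m _; apply: lee_wpmul2l.
Qed.

Variables (f : Rd -> Rd -> Rd) (nu : proba).
Hypothesis updE : kernel_update f nu upd.
Hypothesis regular_upd : forall m (P : proba) (Q : quantizer R d M),
  regular_belief P -> Qc Q -> (0 < P (Q @^-1` [set m]))%E -> regular_belief (upd m P Q).
Hypothesis dp_argmin : forall k P, regular_belief P ->
  exists Q, Qc Q /\ Jrem T upd k.+1 P = dp_bracket T upd (Jrem T upd k) P Q.
Hypothesis Qc_ne : exists Q : quantizer R d M, Qc Q.

(** The beliefs reachable at time [t] depend on the earlier choices, so [reach] follows the selected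
    quantizers by recursion on time, and the policy is read off from it. *)
Lemma optimal_policy (P0 : proba) : regular_belief P0 ->
  exists eta : policy R d M, is_policy eta /\ Jcost T upd eta P0 = Jrem T upd T P0.
Proof.
move=> rP0; have [Q0 QQ0] := Qc_ne; have [sep sepP] := separating_events R d.
have H (kP : nat * proba) : exists Q, Qc Q /\ (regular_belief kP.2 ->
    Jrem T upd kP.1.+1 kP.2 = dp_bracket T upd (Jrem T upd kP.1) kP.2 Q).
  have [r|nr] := pselect (regular_belief kP.2); last by exists Q0; split.
  by have [Q [? ?]] := dp_argmin kP.1 r; exists Q; split.
have /choice[sel hsel] := H.
(* At time [t] there remain [T - t] stages including the current one; the predecessor is the index
   of the value function after it. *)
pose choose L t P := lookup sep L L (fun P' => sel ((T - t).-1, P')) Q0 P.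
pose reach := fix reach t := if t is t'.+1 then
    List.flat_map (fun P => [seq upd m P (choose (reach t') t' P) | m <- enum 'I_M]) (reach t')
  else [:: P0].
pose eta t := choose (reach t) t.
have QQeta t P : Qc (eta t P).
  by apply: lookup_Qc => // P'; have [] := hsel ((T - t).-1, P').
exists eta; split.
  by move=> t; split => // E _; exact: Pmeasurable_lookup.
suff V k t P : (t + k)%N = T -> List.In P (reach t) -> regular_belief P ->
    policy_value T upd eta k t P = Jrem T upd k P.
  by apply: V => //; left.
elim: k t P => [|k IH] t P tk PL rP //.
have [P' [P'P etaE]] := lookupP sepP (fun P' => sel ((T - t).-1, P')) Q0 PL.
have kE : (T - t).-1 = k by rewrite -tk addKn.
have rP' : regular_belief P'.
  by apply: same_law_regular rP => A mA; rewrite P'P.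
have [QQ argmin] := hsel (k, P').
(* The selected quantizer is optimal at [P']; equality of laws transfers its optimality to [P]. *)
transitivity (dp_bracket T upd (Jrem T upd k) P (eta t P)); last first.
  have -> : eta t P = sel (k, P') by rewrite /eta /choose etaE kE.
  rewrite -(same_law_bracket T updE (same_law_Jrem T updE k) P'P QQ) -argmin//.
  exact: (same_law_Jrem T updE k.+1).
rewrite /= /dp_bracket; congr (_ + _)%E; apply: eq_bigr => m _.
(* Null cells contribute 0; the others lead to a belief in [reach t.+1] that is again regular. *)
have := measure_ge0 P (eta t P @^-1` [set m]); rewrite le_eqVlt => /orP[/eqP <-|Pm].
  by rewrite !mul0e.
congr (_ * _)%E; apply: IH; [by rewrite addSnnS| |exact: regular_upd].
apply/List.in_flat_map; exists P; split => //.
rewrite -/(eta t P).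
have : m \in enum 'I_M by rewrite mem_enum.
elim: (enum 'I_M) => //= a s IHs; rewrite inE => /orP[/eqP->|/IHs]; first by left.
by right.
Qed.

End Policies.

(** * The main theorem *)

Section Instances.
Variables (R : realType) (d M : nat).
Local Notation Rd := (d.-tuple R).
Local Notation proba := (probability Rd R).

Lemma density_hyper0 (P : proba) g a b : has_density P g -> nontriv a b -> P (hyper a b) = 0%E.
Proof.
move=> [_ [_ Pg]] nab; rewrite Pg; last exact: measurable_hyper.
by apply: (iint_hyper0 nab) => z nz; rewrite indicE memNset// mul0r.
Qed.

Lemma density_regular (P : proba) g : has_density P g -> fin2 P -> regular_belief P.
Proof.
move=> Pg fP; split => //; exists [tuple 0 | _ < d] => a b nab.
apply/eqP; rewrite -measure_le0 -(density_hyper0 Pg nab); apply: le_measure.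
- by rewrite inE; exact: measurable_hyperD1.
- by rewrite inE; exact: measurable_hyper.
- by move=> x [].
Qed.

Lemma dirac_regular (P : proba) x0 : (forall A, measurable A -> P A = \d_x0 A) -> regular_belief P.
Proof.
move=> Px0; split.
  rewrite /fin2 (eq_measure_integral (dirac x0)) => [|A mA _]; last exact: Px0.
  rewrite integral_dirac//; last by apply/measurable_EFinP; exact: measurable_tsqnorm.
  by rewrite diracT mul1e ltry.
exists x0 => a b _; rewrite Px0; last exact: measurable_hyperD1.
by rewrite /dirac indicE memNset// => -[_]; apply.
Qed.

(** Coordinatewise, the right side minus the left is the square of [x - 2 u]. *)
Lemma tsqnorm_triangle (x u : Rd) : tsqnorm x <= 2 * tsqnorm (tsub x u) + 2 * tsqnorm u.
Proof.
rewrite /tsqnorm !mulr_sumr -big_split; apply: ler_sum => i _ /=.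
by rewrite tnth_mktuple; have := sqr_ge0 (tnth x i - 2 * tnth u i); nra.
Qed.

(** Finite cost gives each cell a point [u] with finite distortion, hence a finite second moment on
    the cell; the finitely many cells cover the space. *)
Lemma qcost_infty (P : proba) (Q : quantizer R d M) : Qc Q -> ~ fin2 P -> qcost P Q = +oo%E.
Proof.
move=> QQ nfP; apply/eqP; rewrite -leye_eq leNgt; apply/negP => cQ; apply: nfP.
have mD i : measurable (Q @^-1` [set i]) by have [] := QQ i.
have mt : measurable_fun setT (fun x : Rd => (tsqnorm x)%:E).
  by apply/measurable_EFinP; exact: measurable_tsqnorm.
have cell i : (\int[P]_(x in Q @^-1` [set i]) (tsqnorm x)%:E < +oo)%E.
  have /ereal_inf_lt[_ [u _ <-] hu] : (cell_cost P (Q @^-1` [set i]) < +oo)%E.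
    apply: le_lt_trans cQ; rewrite /qcost (bigD1 i)//= leeDl//.
    by apply: sume_ge0 => j _; exact: cell_cost_ge0.
  have mu : measurable_fun setT (fun x : Rd => (tsqnorm (tsub x u))%:E).
    apply/measurable_EFinP; apply: measurable_sum => j; apply: measurable_funX.
    rewrite (_ : (fun x => _) = (fun x => tnth x j - tnth u j)); last first.
      by apply/funext => x; rewrite tnth_mktuple.
    by apply: measurable_funB => //; exact: measurable_tnth.
  apply: (@le_lt_trans _ _ (\int[P]_(x in Q @^-1` [set i])
      (2%:E * (tsqnorm (tsub x u))%:E + (2 * tsqnorm u)%:E))%E).
    apply: ge0_le_integral_nomeas => x _; first by rewrite lee_fin tsqnorm_ge0.
    by rewrite -EFinM -EFinD lee_fin tsqnorm_triangle.
  have t0 : (0 <= (2 * tsqnorm u)%:E)%E by rewrite lee_fin mulr_ge0// tsqnorm_ge0.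
  rewrite ge0_integralD//; first last.
  - by apply: measurable_funTS; apply: measurable_funeM.
  - by move=> x _; rewrite mule_ge0// lee_fin tsqnorm_ge0.
  rewrite ge0_integralZl//; first last.
  - by move=> x _; rewrite lee_fin tsqnorm_ge0.
  - exact: measurable_funTS.
  apply: lte_add_pinfty; first by rewrite lte_mul_pinfty.
  rewrite (integral_cst P (mD i)) lte_mul_pinfty//.
  by rewrite -ge0_fin_numE// fin_num_measure.
rewrite /fin2 (_ : (fun x => _) = fun x : Rd => (\sum_(i < M) (\1_(Q @^-1` [set i]) x * tsqnorm x)%:E)%E).
  rewrite ge0_integral_sum//.
  - apply: lte_sum_pinfty => i _; apply: le_lt_trans (cell i).
    rewrite [leRHS]integral_mkcond le_eqVlt; apply/orP; left; apply/eqP.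
    apply: eq_integral => x _; rewrite patchE indicE.
    by case: (boolP (x \in _)) => _; rewrite ?mul1r ?mul0r.
  - move=> i; apply/measurable_EFinP; apply: measurable_funM; first exact: measurable_indic.
    exact: measurable_tsqnorm.
  - by move=> i x _; rewrite lee_fin mulr_ge0// tsqnorm_ge0.
apply/funext => x; rewrite (bigD1 (Q x))//= indicE mem_set// mul1r big1 ?adde0// => j jQ.
by rewrite indicE memNset ?mul0r//= => /esym/eqP; apply/negP.
Qed.

Lemma dp_bracket_infty T upd J (P : proba) (Q : quantizer R d M) : (0 < T)%N ->
  (forall P', 0 <= J P')%E -> Qc Q -> ~ fin2 P -> dp_bracket T upd J P Q = +oo%E.
Proof.
move=> T0 J0 QQ nfP; rewrite /dp_bracket qcost_infty// gt0_muley ?lte_fin ?invr_gt0 ?ltr0n//.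
rewrite addye// gt_eqF//; apply: lt_le_trans (ltNyr 0) _.
by apply: sume_ge0 => m _; rewrite mule_ge0.
Qed.

Lemma kernel_wt_bound (f : Rd -> Rd -> Rd) (nu : proba) K : 0 < K ->
  measurable_fun [set: Rd * Rd] (fun p : Rd * Rd => f p.1 p.2) ->
  (forall x w, tnorm (f x w) <= K * (tnorm x + tnorm w)) -> fin2 nu ->
  exists c2, forall x, (\int[nu]_w (wt (f x w))%:E <= (c2 * wt x)%:E)%E.
Proof.
move=> K0 hf growth mom.
have sq (x : Rd) : tnorm x ^+ 2 = tsqnorm x by rewrite sqr_sqrtr// tsqnorm_ge0.
have g2 x w : wt (f x w) <= (1 + 2 * K ^+ 2 * tsqnorm x) + 2 * K ^+ 2 * tsqnorm w.
  rewrite /wt -addrA lerD2l -!sq.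
  have n0 (y : Rd) : 0 <= tnorm y by exact: sqrtr_ge0.
  apply: le_trans (_ : (K * (tnorm x + tnorm w)) ^+ 2 <= _).
    by rewrite ler_pXn2r ?nnegrE// mulr_ge0 ?(ltW K0)// addr_ge0.
  rewrite -subr_ge0 (_ : _ - _ = K ^+ 2 * (tnorm x - tnorm w) ^+ 2); last by ring.
  by rewrite mulr_ge0 ?sqr_ge0.
pose mw := fine (\int[nu]_w (tsqnorm w)%:E)%E.
have i0 : (0 <= \int[nu]_w (tsqnorm w)%:E)%E.
  by apply: integral_ge0 => w _; rewrite lee_fin tsqnorm_ge0.
have mwE : (\int[nu]_w (tsqnorm w)%:E)%E = mw%:E by rewrite fineK// ge0_fin_numE.
have mw0 : 0 <= mw by exact: fine_ge0.
(* From [|f x w|^2 <= 2 K^2 (|x|^2 + |w|^2)], integrated in [w], with all constants collected in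
   front of [wt x]. *)
exists (1 + 2 * K ^+ 2 + 2 * K ^+ 2 * mw) => x.
have k0 : 0 <= 2 * K ^+ 2 by rewrite mulr_ge0// sqr_ge0.
have a0 : 0 <= 1 + 2 * K ^+ 2 * tsqnorm x by rewrite addr_ge0// mulr_ge0// tsqnorm_ge0.
apply: (@le_trans _ _ (\int[nu]_w ((1 + 2 * K ^+ 2 * tsqnorm x)%:E + (2 * K ^+ 2)%:E * (tsqnorm w)%:E))%E).
  apply: ge0_le_integral_nomeas => w _; first by rewrite lee_fin wt_ge0.
  by rewrite -EFinM -EFinD lee_fin.
have mt : measurable_fun setT (fun x : Rd => (tsqnorm x)%:E).
  by apply/measurable_EFinP; exact: measurable_tsqnorm.
rewrite ge0_integralD//; first last.
- by apply: measurable_funeM.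
- by move=> w _; rewrite mule_ge0// lee_fin// tsqnorm_ge0.
rewrite ge0_integralZl//; first last.
- by move=> w _; rewrite lee_fin tsqnorm_ge0.
have cst (r : R) : (\int[nu]_w r%:E = r%:E)%E.
  apply: etrans (integral_cst _ _ _) _ => //.
  by rewrite -[RHS]mule1; congr (_ * _)%E; exact: probability_setT.
rewrite cst mwE.
rewrite -EFinM -EFinD lee_fin /wt.
have := tsqnorm_ge0 x; move: (tsqnorm x) => s s0.
have := mulr_ge0 k0 mw0; move: (2 * K ^+ 2 * mw) => q q0.
by move: k0; move: (2 * K ^+ 2) => k k0; nra.
Qed.

End Instances.

Theorem theorem5 (R : realType) (d M T : nat)
  (hM : (0 < M)%N) (hT : (1 <= T)%N)
  (* Assumption 1 *)
  (f : d.-tuple R -> d.-tuple R -> d.-tuple R)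
  (hf : measurable_fun [set: d.-tuple R * d.-tuple R]
          (fun p : d.-tuple R * d.-tuple R => f p.1 p.2))
  (nu_w pi0 : probability (d.-tuple R) R)
  (phi : d.-tuple R -> d.-tuple R -> R) (C C1 : R)
  (phi_dens : forall (x : d.-tuple R) (A : set (d.-tuple R)), measurable A ->
      nu_w [set w | A (f x w)] = iint (fun z => (\1_A z * phi z x)%:E))
  (phi_pos : forall z x, 0 < phi z x)
  (phi_bd : forall z x, phi z x <= C)
  (phi_lip : forall z z' x, `|phi z x - phi z' x| <= C1 * tnorm (tsub z z'))
  (* Assumption 3 *)
  (K : R) (hK : 0 < K)
  (f_growth : forall x w, tnorm (f x w) <= K * (tnorm x + tnorm w))
  (nu_mom : (\int[nu_w]_z (tsqnorm z)%:E < +oo)%E)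
  (pi0_cond : ((exists g, has_density pi0 g) /\
                 (\int[pi0]_x (tsqnorm x)%:E < +oo)%E) \/
              (exists x0 : d.-tuple R, forall A, measurable A -> pi0 A = \d_x0 A))
  (* the belief update pi-hat *)
  (upd : belief_update R d M) (hupd : is_belief_update phi upd) :
  (exists eta : policy R d M, is_policy eta /\
     Jcost T upd eta pi0 = ereal_inf [set Jcost T upd eta' pi0 | eta' in @is_policy R d M]) /\
  (forall t : nat, (1 <= t <= T - 1)%N -> forall P, inS C C1 P ->
     exists Q, Qc Q /\ JT T upd t P = dp_bracket T upd (JT T upd t.+1) P Q) /\
  (exists Q, Qc Q /\ JT T upd 0 pi0 = dp_bracket T upd (JT T upd 1) pi0 Q) /\
  JT T upd 0 pi0 = ereal_inf [set Jcost T upd eta' pi0 | eta' in @is_policy R d M].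
Proof.
have phi_ge0 z x : 0 <= phi z x by exact: ltW.
have updE := upd_integral hf phi_dens phi_ge0 phi_lip hupd.
have [c2 kernel_wt] := kernel_wt_bound hK hf f_growth nu_mom.
have kernel_hyper a b : nontriv a b -> forall x, nu_w [set w | hyper a b (f x w)] = 0%E.
  move=> nab x; rewrite phi_dens; last exact: measurable_hyper.
  by apply: (iint_hyper0 nab) => z nz; rewrite indicE memNset// mul0r.
have argmin := dp_argmin T hM hf updE kernel_wt kernel_hyper.
have rupd m P (Q : quantizer R d M) : regular_belief P -> Qc Q ->
    (0 < P (Q @^-1` [set m]))%E -> regular_belief (upd m P Q).
  by move=> [fP _]; exact: (regular_upd hf updE kernel_wt kernel_hyper).
have rpi0 : regular_belief pi0.
  case: pi0_cond => [[[g pg] m2]|[x0 px0]]; first exact: density_regular pg m2.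
  exact: dirac_regular px0.
have [eta [peta etaE]] := optimal_policy updE rupd argmin (@Qc_cst R d M hM) rpi0.
have infE : Jrem T upd T pi0 = ereal_inf [set Jcost T upd eta' pi0 | eta' in @is_policy R d M].
  apply/eqP; rewrite eq_le; apply/andP; split.
    by apply: le_ereal_inf_tmp => _ [eta' peta' <-]; exact: policy_value_ge.
  by rewrite -etaE; apply: ereal_inf_lbound; exists eta.
split; first by exists eta; rewrite etaE.
have stepE t : (t < T)%N -> (T - t)%N = (T - t.+1).+1 by move=> tT; rewrite subnSK.
split.
  move=> t /andP[t1 tT] P [g [Pg _]].
  have {}tT : (t < T)%N by rewrite -(prednK hT) ltnS -subn1.
  rewrite /JT stepE//.
  have [fP|nfP] := pselect (fin2 P); first exact: argmin (density_regular Pg fP).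
  (* With infinite second moment both sides are [+oo], whatever the quantizer. *)
  have [Q QQ] := @Qc_cst R d M hM; exists Q; split => //.
  have inf Q' : Qc Q' -> dp_bracket T upd (Jrem T upd (T - t.+1)) P Q' = +oo%E.
    by move=> QQ'; apply: dp_bracket_infty => // P'; exact: Jrem_ge0.
  rewrite inf//=; apply/eqP; rewrite -leye_eq; apply: le_ereal_inf_tmp => _ [Q' QQ' <-].
  by rewrite inf.
split; last by rewrite /JT subn0 infE.
by rewrite /JT (stepE 0%N)//; exact: argmin.
Qed.
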